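(* Let $S,T$ be as in the context. Every $\Sigma_1$ provability predicate $\mathrm{Pr}_T(x)$ of $T$ satisfying $\mathbf{E}^{\mathrm{U}}$, $\mathbf{CB}_{\exists}$ and $\mathbf{C}$ also satisfies $\mathbf{D2}$ and $\mathbf{D3}$.
   Context: $\mathcal{L}_A=\{0,\mathsf{s},+,\times,\leq\}$ is the language of first-order arithmetic, and ''formula'' means $\mathcal{L}_A$-formula; $\ulcorner\varphi\urcorner$ is the numeral of the Gödel number of $\varphi$. $\Sigma_1$ formulas are those of the form $\exists\vec{x}\,\delta$ with $\delta$ a $\Delta_0$ formula. $S$ and $T$ are consistent c.e. extensions of Peano Arithmetic $\mathsf{PA}$ in the language $\mathcal{L}_A$ such that $T$ is stronger than $S$ (every theorem of $S$ is a theorem of $T$; $S=T$ is allowed). A formula $\mathrm{Pr}_T(x)$ is a provability predicate of $T$ if for every formula $\varphi$: $T\vdash\varphi$ if and only if $S\vdash\mathrm{Pr}_T(\ulcorner\varphi\urcorner)$. A $\Sigma_1$ provability predicate is one that is a $\Sigma_1$ formula. $\ulcorner\varphi(\vec{\dot{x}})\urcorner$ is a term with free variables $\vec{x}$ for the primitive recursive function that computes from $\vec{n}$ the Gödel number of $\varphi(\overline{\vec{n}})$, the result of substituting the numerals of $\vec{n}$ for $\vec{x}$ in $\varphi(\vec{x})$. Conditions on $\mathrm{Pr}_T(x)$: - $\mathbf{E}^{\mathrm{U}}$: for all formulas $\varphi(\vec{x}),\psi(\vec{x})$, if $T\vdash\forall\vec{x}\,(\varphi(\vec{x})\leftrightarrow\psi(\vec{x}))$,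 then $S\vdash\forall\vec{x}\,(\mathrm{Pr}_T(\ulcorner\varphi(\vec{\dot{x}})\urcorner)\leftrightarrow\mathrm{Pr}_T(\ulcorner\psi(\vec{\dot{x}})\urcorner))$. - $\mathbf{CB}_{\exists}$: $S\vdash\exists\vec{x}\,\mathrm{Pr}_T(\ulcorner\varphi(\vec{\dot{x}})\urcorner)\to\mathrm{Pr}_T(\ulcorner\exists\vec{x}\,\varphi(\vec{x})\urcorner)$ for every formula $\varphi(\vec{x})$. - $\mathbf{C}$: $S\vdash\mathrm{Pr}_T(\ulcorner\varphi\urcorner)\land\mathrm{Pr}_T(\ulcorner\psi\urcorner)\to\mathrm{Pr}_T(\ulcorner\varphi\land\psi\urcorner)$ for all formulas $\varphi,\psi$. - $\mathbf{D2}$: $S\vdash\mathrm{Pr}_T(\ulcorner\varphi\to\psi\urcorner)\to(\mathrm{Pr}_T(\ulcorner\varphi\urcorner)\to\mathrm{Pr}_T(\ulcorner\psi\urcorner))$ for all formulas $\varphi,\psi$. - $\mathbf{D3}$: $S\vdash\mathrm{Pr}_T(\ulcorner\varphi\urcorner)\to\mathrm{Pr}_T(\ulcorner\mathrm{Pr}_T(\ulcorner\varphi\urcorner)\urcorner)$ for every formula $\varphi$. *)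

(* Defs.v *)
From Stdlib Require Import Arith List Lia.

(** * Syntax of first-order arithmetic

    Variables are de Bruijn indices.  In a formula phi(x_0,...,x_{n-1}), possibly
    with further parameters, the displayed variables are the indices
    0, ..., n-1 and the parameters are the indices >= n; [exn n phi] and
    [alln n phi] bind exactly the displayed variables. *)

Inductive term : Type :=
| Var (i : nat)
| Zero
| Succ (t : term)
| Add (t u : term)
| Mul (t u : term).

Inductive form : Type :=
| Bot
| Eq (t u : term)
| Le (t u : term)
| Imp (p q : form)
| And (p q : form)
| Or (p q : form)
| All (p : form)
| Ex (p : form).

Definition Neg (p : form) : form := Imp p Bot.
Definition Iff (p q : form) : form := And (Imp p q) (Imp q p).

Definition alln (n : nat) (p : form) : form := Nat.iter n All p.
Definition exn (n : nat) (p : form) : form := Nat.iter n Ex p.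

Definition num (n : nat) : term := Nat.iter n Succ Zero.

Fixpoint tsubst (s : nat -> term) (t : term) : term :=
  match t with
  | Var i => s i
  | Zero => Zero
  | Succ t => Succ (tsubst s t)
  | Add t u => Add (tsubst s t) (tsubst s u)
  | Mul t u => Mul (tsubst s t) (tsubst s u)
  end.

Definition tshift : term -> term := tsubst (fun i => Var (S i)).

Definition scons (t : term) (s : nat -> term) (i : nat) : term :=
  match i with 0 => t | S j => s j end.

Definition up (s : nat -> term) : nat -> term :=
  scons (Var 0) (fun i => tshift (s i)).

Fixpoint subst (s : nat -> term) (p : form) : form :=
  match p with
  | Bot => Bot
  | Eq t u => Eq (tsubst s t) (tsubst s u)
  | Le t u => Le (tsubst s t) (tsubst s u)
  | Imp p q => Imp (subst s p) (subst s q)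
  | And p q => And (subst s p) (subst s q)
  | Or p q => Or (subst s p) (subst s q)
  | All p => All (subst (up s) p)
  | Ex p => Ex (subst (up s) p)
  end.

Definition shift : form -> form := subst (fun i => Var (S i)).

(** p(t): replace variable 0 by t and lower the other variables. *)
Definition inst (p : form) (t : term) : form := subst (scons t Var) p.

(** All free variables are < n. *)
Fixpoint tbound (n : nat) (t : term) : Prop :=
  match t with
  | Var i => i < n
  | Zero => True
  | Succ t => tbound n t
  | Add t u | Mul t u => tbound n t /\ tbound n u
  end.

Fixpoint fbound (n : nat) (p : form) : Prop :=
  match p with
  | Bot => True
  | Eq t u | Le t u => tbound n t /\ tbound n u
  | Imp p q | And p q | Or p q => fbound n p /\ fbound n q
  | All p | Ex p => fbound (S n) p
  end.

(** ** Arithmetical hierarchy *)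

Inductive Delta0 : form -> Prop :=
| D0_Bot : Delta0 Bot
| D0_Eq t u : Delta0 (Eq t u)
| D0_Le t u : Delta0 (Le t u)
| D0_Imp p q : Delta0 p -> Delta0 q -> Delta0 (Imp p q)
| D0_And p q : Delta0 p -> Delta0 q -> Delta0 (And p q)
| D0_Or p q : Delta0 p -> Delta0 q -> Delta0 (Or p q)
| D0_All t p : Delta0 p -> Delta0 (All (Imp (Le (Var 0) (tshift t)) p))
| D0_Ex t p : Delta0 p -> Delta0 (Ex (And (Le (Var 0) (tshift t)) p)).

Definition Sigma1 (p : form) : Prop :=
  exists (n : nat) (d : form), Delta0 d /\ p = exn n d.

(** * Classical first-order logic with equality

    Natural deduction with local hypotheses G over a set T of axioms.  The
    axioms are not shifted under quantifiers: the calculus is used only for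
    sets of sentences. *)

Inductive prv (T : form -> Prop) : list form -> form -> Prop :=
| P_Ax G p : T p -> prv T G p
| P_Hyp G p : In p G -> prv T G p
| P_ImpI G p q : prv T (p :: G) q -> prv T G (Imp p q)
| P_ImpE G p q : prv T G (Imp p q) -> prv T G p -> prv T G q
| P_AndI G p q : prv T G p -> prv T G q -> prv T G (And p q)
| P_AndE1 G p q : prv T G (And p q) -> prv T G p
| P_AndE2 G p q : prv T G (And p q) -> prv T G q
| P_OrI1 G p q : prv T G p -> prv T G (Or p q)
| P_OrI2 G p q : prv T G q -> prv T G (Or p q)
| P_OrE G p q r :
    prv T G (Or p q) -> prv T (p :: G) r -> prv T (q :: G) r -> prv T G r
| P_AllI G p : prv T (map shift G) p -> prv T G (All p)
| P_AllE G p t : prv T G (All p) -> prv T G (inst p t)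
| P_ExI G p t : prv T G (inst p t) -> prv T G (Ex p)
| P_ExE G p q :
    prv T G (Ex p) -> prv T (p :: map shift G) (shift q) -> prv T G q
| P_Raa G p : prv T (Neg p :: G) Bot -> prv T G p
| P_EqI G t : prv T G (Eq t t)
| P_EqE G t u p : prv T G (Eq t u) -> prv T G (inst p t) -> prv T G (inst p u).

Definition proves (T : form -> Prop) (p : form) : Prop := prv T nil p.

Notation "T |-- p" := (proves T p) (at level 70, no associativity).

Definition consistent (T : form -> Prop) : Prop := ~ (T |-- Bot).

Definition sentences (T : form -> Prop) : Prop := forall p, T p -> fbound 0 p.

Definition stronger (T S : form -> Prop) : Prop :=
  forall p, S |-- p -> T |-- p.

(** * Peano Arithmetic *)

Definition induction (p : form) : form :=
  Imp (inst p Zero)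
   (Imp (All (Imp p (subst (scons (Succ (Var 0)) (fun i => Var (S i))) p)))
     (All p)).

Inductive PA : form -> Prop :=
| PA_succ0 : PA (All (Neg (Eq (Succ (Var 0)) Zero)))
| PA_succ_inj :
    PA (All (All (Imp (Eq (Succ (Var 1)) (Succ (Var 0))) (Eq (Var 1) (Var 0)))))
| PA_add0 : PA (All (Eq (Add (Var 0) Zero) (Var 0)))
| PA_addS :
    PA (All (All (Eq (Add (Var 1) (Succ (Var 0))) (Succ (Add (Var 1) (Var 0))))))
| PA_mul0 : PA (All (Eq (Mul (Var 0) Zero) Zero))
| PA_mulS :
    PA (All (All (Eq (Mul (Var 1) (Succ (Var 0)))
                     (Add (Mul (Var 1) (Var 0)) (Var 1)))))
| PA_le :
    PA (All (All (Iff (Le (Var 1) (Var 0))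
                      (Ex (Eq (Add (Var 0) (Var 2)) (Var 1))))))
| PA_induct n p : fbound (S n) p -> PA (alln n (induction p)).

(** * Goedel numbering

    [pair] is an injective pairing function that is the value of an
    arithmetical term.  Formulas and terms are coded by tagged pairing, except
    that a block of successors is coded by its length: a term s^k(u), with u
    not a successor, is coded by the pair of k and the code of u.  With this
    numbering, the function sending n_0,...,n_{m-1} to the code of the formula
    phi(n_0,...,n_{m-1}) (with numerals substituted) is, for each fixed phi, a
    polynomial, hence denoted by a term [gdot] of the language; see
    [gform_inj], [gdot_spec] and [gdot_bound]. *)

Definition pair (a b : nat) : nat := (a + b) * (a + b) + a.

(** [gterm k t] is the code of s^k(t). *)
Fixpoint gterm (k : nat) (t : term) : nat :=
  match t with
  | Succ u => gterm (S k) u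
  | Zero => pair k (pair 0 0)
  | Var i => pair k (pair 1 i)
  | Add t u => pair k (pair 2 (pair (gterm 0 t) (gterm 0 u)))
  | Mul t u => pair k (pair 3 (pair (gterm 0 t) (gterm 0 u)))
  end.

Fixpoint gform (p : form) : nat :=
  match p with
  | Bot => pair 0 0
  | Eq t u => pair 1 (pair (gterm 0 t) (gterm 0 u))
  | Le t u => pair 2 (pair (gterm 0 t) (gterm 0 u))
  | Imp p q => pair 3 (pair (gform p) (gform q))
  | And p q => pair 4 (pair (gform p) (gform q))
  | Or p q => pair 5 (pair (gform p) (gform q))
  | All p => pair 6 (gform p)
  | Ex p => pair 7 (gform p)
  end.

Definition quote (p : form) : term := num (gform p).

Definition tpair (a b : term) : term := Add (Mul (Add a b) (Add a b)) a.

(** [gdot n p] is the term written with dotted variables x_0,...,x_{n-1}.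
    Below l binders, the indices < l are bound, the next n indices are the
    dotted variables, which are replaced by numerals, and the remaining
    parameters of p stay (lowered) variables of the quoted formula. *)
Fixpoint gdot_term (n l k : nat) (t : term) : term :=
  match t with
  | Succ u => gdot_term n l (S k) u
  | Zero => tpair (num k) (num (pair 0 0))
  | Var i =>
      if i <? l then tpair (num k) (num (pair 1 i))
      else if i <? l + n
      then tpair (Nat.iter k Succ (Var (i - l))) (num (pair 0 0))
      else tpair (num k) (num (pair 1 (i - n)))
  | Add t u =>
      tpair (num k)
        (tpair (num 2) (tpair (gdot_term n l 0 t) (gdot_term n l 0 u)))
  | Mul t u =>
      tpair (num k)
        (tpair (num 3) (tpair (gdot_term n l 0 t) (gdot_term n l 0 u)))
  end.

Fixpoint gdot_form (n l : nat) (p : form) : term :=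
  match p with
  | Bot => tpair (num 0) (num 0)
  | Eq t u =>
      tpair (num 1) (tpair (gdot_term n l 0 t) (gdot_term n l 0 u))
  | Le t u =>
      tpair (num 2) (tpair (gdot_term n l 0 t) (gdot_term n l 0 u))
  | Imp p q => tpair (num 3) (tpair (gdot_form n l p) (gdot_form n l q))
  | And p q => tpair (num 4) (tpair (gdot_form n l p) (gdot_form n l q))
  | Or p q => tpair (num 5) (tpair (gdot_form n l p) (gdot_form n l q))
  | All p => tpair (num 6) (gdot_form n (S l) p)
  | Ex p => tpair (num 7) (gdot_form n (S l) p)
  end.

Definition gdot (n : nat) (p : form) : term := gdot_form n 0 p.

Lemma pair_inj a b c d : pair a b = pair c d -> a = c /\ b = d.
Proof.
unfold pair; intros H.
assert (a + b = c + d) by nia.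
assert (a = c) by nia.
lia.
Qed.

Lemma iter_Succ_comm k t : Nat.iter k Succ (Succ t) = Nat.iter (S k) Succ t.
Proof. induction k as [|k IH]; simpl in *; congruence. Qed.

Ltac pair_inv :=
  repeat match goal with
  | H : pair _ _ = pair _ _ |- _ => apply pair_inj in H; destruct H
  end; try discriminate.

Lemma gterm_inj t u k m :
  gterm k t = gterm m u -> Nat.iter k Succ t = Nat.iter m Succ u.
Proof.
revert u k m; induction t as [i| |t IH|t1 IH1 t2 IH2|t1 IH1 t2 IH2];
  intros u k m H; cbn [gterm] in H.
3: rewrite iter_Succ_comm; apply IH; exact H.
all: revert m H; induction u as [j| |u IHu|u1 _ u2 _|u1 _ u2 _];
  intros m H; cbn [gterm] in H;
  try (rewrite iter_Succ_comm; apply IHu; exact H); pair_inv; subst;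
  try reflexivity.
all: apply IH1 in H1; apply IH2 in H2; simpl in H1, H2; now subst.
Qed.

Lemma gform_inj p q : gform p = gform q -> p = q.
Proof.
revert q; induction p; intros [] H; cbn [gform] in H; pair_inv;
repeat match goal with
  | H : gterm 0 _ = gterm 0 _ |- _ => apply gterm_inj in H; simpl in H
  end; f_equal; auto.
Qed.

Fixpoint teval (v : nat -> nat) (t : term) : nat :=
  match t with
  | Var i => v i
  | Zero => 0
  | Succ t => S (teval v t)
  | Add t u => teval v t + teval v u
  | Mul t u => teval v t * teval v u
  end.

(** Substitution of the numerals of v 0, ..., v (n-1) for the first n
    variables. *)
Definition num_subst (n : nat) (v : nat -> nat) (i : nat) : term :=
  if i <? n then num (v i) else Var (i - n).

Lemma teval_iter_Succ v k t : teval v (Nat.iter k Succ t) = k + teval v t.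
Proof. induction k as [|k IH]; simpl; congruence. Qed.

Lemma teval_num v k : teval v (num k) = k.
Proof. unfold num; rewrite teval_iter_Succ; simpl; lia. Qed.

Lemma tshift_num k : tshift (num k) = num k.
Proof.
induction k as [|k IH]; [reflexivity|].
change (Succ (tshift (num k)) = Succ (num k)); now rewrite IH.
Qed.

Lemma gterm_num k m : gterm k (num m) = pair (k + m) (pair 0 0).
Proof.
revert k; induction m as [|m IH]; intros k; cbn [num Nat.iter nat_rect gterm].
- now rewrite Nat.add_0_r.
- change (gterm (S k) (num m) = pair (k + S m) (pair 0 0)).
  rewrite IH; f_equal; lia.
Qed.

Lemma iter_up_num_subst n v l i :
  Nat.iter l up (num_subst n v) i =
  if i <? l then Var i
  else if i <? l + n then num (v (i - l)) else Var (i - n).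
Proof.
revert i; induction l as [|l IH]; intros i.
- simpl; unfold num_subst; now rewrite Nat.sub_0_r.
- destruct i as [|i]; [reflexivity|].
  change (tshift (Nat.iter l up (num_subst n v) i) =
          if i <? l then Var (S i)
          else if i <? l + n then num (v (i - l)) else Var (S i - n)).
  rewrite IH; destruct (Nat.ltb_spec i l); [reflexivity|].
  destruct (Nat.ltb_spec i (l + n)); [apply tshift_num|].
  change (Var (S (i - n)) = Var (S i - n)); apply f_equal; lia.
Qed.

Lemma teval_tpair v a b : teval v (tpair a b) = pair (teval v a) (teval v b).
Proof. reflexivity. Qed.

Lemma gdot_term_spec n v l k t :
  teval v (gdot_term n l k t) =
  gterm k (tsubst (Nat.iter l up (num_subst n v)) t).
Proof.
revert k; induction t as [i| |t IH|t IHt u IHu|t IHt u IHu]; intros k;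
  cbn [gdot_term tsubst gterm].
- rewrite iter_up_num_subst.
  destruct (i <? l); [|destruct (i <? l + n)];
    rewrite teval_tpair, ?teval_iter_Succ, !teval_num, ?gterm_num; reflexivity.
- now rewrite teval_tpair, !teval_num.
- apply IH.
- now rewrite !teval_tpair, !teval_num, IHt, IHu.
- now rewrite !teval_tpair, !teval_num, IHt, IHu.
Qed.

Lemma gdot_form_spec n v l p :
  teval v (gdot_form n l p) =
  gform (subst (Nat.iter l up (num_subst n v)) p).
Proof.
revert l; induction p; intros l; cbn [gdot_form subst gform];
  rewrite ?teval_tpair, ?teval_num, ?gdot_term_spec, ?IHp1, ?IHp2, ?IHp;
  reflexivity.
Qed.

Lemma gdot_spec n v p :
  teval v (gdot n p) = gform (subst (num_subst n v) p).
Proof. apply gdot_form_spec. Qed.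

Lemma tbound_iter_Succ n k t : tbound n t -> tbound n (Nat.iter k Succ t).
Proof. induction k; simpl; auto. Qed.

Lemma tbound_num n k : tbound n (num k).
Proof. now apply tbound_iter_Succ. Qed.

Lemma tbound_tpair n a b : tbound n a -> tbound n b -> tbound n (tpair a b).
Proof. simpl; auto. Qed.

Lemma gdot_term_bound n l k t : tbound n (gdot_term n l k t).
Proof.
revert k; induction t as [i| | | |]; intros k; cbn [gdot_term];
  try solve [auto using tbound_tpair, tbound_num].
destruct (Nat.ltb_spec i l); [auto using tbound_tpair, tbound_num|].
destruct (Nat.ltb_spec i (l + n)); [|auto using tbound_tpair, tbound_num].
apply tbound_tpair; [apply tbound_iter_Succ; simpl; lia|apply tbound_num].
Qed.

Lemma gdot_bound n p : tbound n (gdot n p).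
Proof.
unfold gdot; generalize 0 as l.
induction p; intros l; cbn [gdot_form];
  auto using tbound_tpair, tbound_num, gdot_term_bound.
Qed.

(** * Computable enumerability

    Partial recursive functions on tuples; an expression applied to a tuple of
    the wrong length is undefined or ignores the superfluous entries. *)

Inductive recf : Type :=
| RZero
| RSucc
| RProj (i : nat)
| RComp (f : recf) (gs : list recf)
| RPrec (f g : recf)
| RMu (f : recf).

Inductive reval : recf -> list nat -> nat -> Prop :=
| RE_Zero v : reval RZero v 0
| RE_Succ x v : reval RSucc (x :: v) (S x)
| RE_Proj i v x : nth_error v i = Some x -> reval (RProj i) v x
| RE_Comp f gs v ws y : revals gs v ws -> reval f ws y -> reval (RComp f gs) v y
| RE_Prec0 f g v y : reval f v y -> reval (RPrec f g) (0 :: v) y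
| RE_PrecS f g n v z y :
    reval (RPrec f g) (n :: v) z -> reval g (n :: z :: v) y ->
    reval (RPrec f g) (S n :: v) y
| RE_Mu f v n :
    reval f (n :: v) 0 ->
    (forall m, m < n -> exists k, reval f (m :: v) (S k)) ->
    reval (RMu f) v n
with revals : list recf -> list nat -> list nat -> Prop :=
| RE_nil v : revals nil v nil
| RE_cons g gs v y ys :
    reval g v y -> revals gs v ys -> revals (g :: gs) v (y :: ys).

Definition ce_set (P : nat -> Prop) : Prop :=
  exists f : recf, forall n, P n <-> exists y, reval f (n :: nil) y.

Definition ce (T : form -> Prop) : Prop :=
  ce_set (fun n => exists p, T p /\ n = gform p).

(** A theory is given by its set of axioms. *)
Definition ce_extension_of_PA (T : form -> Prop) : Prop :=
  sentences T /\ ce T /\ stronger T PA.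

(** * Provability predicates *)

Definition provability_predicate (S T : form -> Prop) (Pr : form) : Prop :=
  fbound 1 Pr /\ forall p, T |-- p <-> S |-- inst Pr (quote p).

Definition cond_EU (S T : form -> Prop) (Pr : form) : Prop :=
  forall (n : nat) (p q : form),
    T |-- alln n (Iff p q) ->
    S |-- alln n (Iff (inst Pr (gdot n p)) (inst Pr (gdot n q))).

Definition cond_CBex (S : form -> Prop) (Pr : form) : Prop :=
  forall (n : nat) (p : form),
    S |-- Imp (exn n (inst Pr (gdot n p))) (inst Pr (quote (exn n p))).

Definition cond_C (S : form -> Prop) (Pr : form) : Prop :=
  forall p q : form,
    S |-- Imp (And (inst Pr (quote p)) (inst Pr (quote q)))
              (inst Pr (quote (And p q))).

Definition cond_D2 (S : form -> Prop) (Pr : form) : Prop :=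
  forall p q : form,
    S |-- Imp (inst Pr (quote (Imp p q)))
              (Imp (inst Pr (quote p)) (inst Pr (quote q))).

Definition cond_D3 (S : form -> Prop) (Pr : form) : Prop :=
  forall p : form,
    S |-- Imp (inst Pr (quote p))
              (inst Pr (quote (inst Pr (quote p)))).

(* Main.v *)
From Stdlib Require Import Arith List Lia.
Require Import Defs.
Import ListNotations.

(** D2: if T proves p -> q, then p and q are T-equivalent to the instances x(0)
    and x(1) of x(v) := q /\ (v = 0 -> p), and q is T-equivalent to the formula
    Ex x; hence E^U and CB_ex give Pr(p) -> Pr(q), and C turns this monotonicity
    into D2.

    D3 follows from provable Sigma1-completeness, and CB_ex reduces that to the
    Delta0 case, which uses E^U alone.  The invariant is that a Delta0 formula c
    with dotted variables is decided inside Pr: S proves that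
    Pr("if c then p else q") is equivalent to Pr(p) if c holds, and to Pr(q)
    otherwise.  Since E^U only sees T-provable equivalence, connectives become
    nested conditionals.  To treat atomic formulas, S proves that the value of a
    term t(x) may be put for a dotted variable inside Pr by quoting t itself;
    for sums and products this is an induction in S that changes the dotted
    numerals one successor at a time.  Then a witness z of t <= u lets u be
    quoted as z + t, where the inequality is provable.  Bounded quantifiers are
    again handled by induction in S on the bound. *)

(** * Free variables and substitution *)

Lemma tbound_mono n m t : n <= m -> tbound n t -> tbound m t.
Proof. intros Hnm; induction t; simpl; intuition lia. Qed.

Lemma fbound_mono n m p : n <= m -> fbound n p -> fbound m p.
Proof.
revert n m; induction p; simpl; intros n m Hnm Hp;
  intuition eauto using tbound_mono.
all: apply IHp with (2 := Hp); lia.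
Qed.

Lemma tbound_exists t : exists n, tbound n t.
Proof.
induction t as [i| |t IH|t [a Ha] u [b Hb]|t [a Ha] u [b Hb]]; simpl.
- exists (S i); lia.
- now exists 0.
- exact IH.
- exists (max a b); eauto using tbound_mono, Nat.le_max_l, Nat.le_max_r.
- exists (max a b); eauto using tbound_mono, Nat.le_max_l, Nat.le_max_r.
Qed.

Lemma fbound_exists p : exists n, fbound n p.
Proof.
induction p as [|t u|t u|p [a Ha] q [b Hb]|p [a Ha] q [b Hb]|p [a Ha] q [b Hb]
  |p [a Ha]|p [a Ha]]; simpl.
1: now exists 0.
1,2: destruct (tbound_exists t) as [a Ha], (tbound_exists u) as [b Hb];
  exists (max a b); eauto using tbound_mono, Nat.le_max_l, Nat.le_max_r.
1-3: exists (max a b); eauto using fbound_mono, Nat.le_max_l, Nat.le_max_r.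
all: exists a; eauto using fbound_mono.
Qed.

Lemma fbound_exn m n p : fbound m (exn n p) <-> fbound (n + m) p.
Proof.
revert m; induction n as [|n IH]; intros m; [reflexivity|].
change (fbound (S m) (exn n p) <-> fbound (S n + m) p); rewrite IH.
now replace (n + S m) with (S n + m) by lia.
Qed.

Lemma fbound_alln m n p : fbound m (alln n p) <-> fbound (n + m) p.
Proof.
revert m; induction n as [|n IH]; intros m; [reflexivity|].
change (fbound (S m) (alln n p) <-> fbound (S n + m) p); rewrite IH.
now replace (n + S m) with (S n + m) by lia.
Qed.

Lemma tsubst_ext_bound n s s' t :
  tbound n t -> (forall i, i < n -> s i = s' i) -> tsubst s t = tsubst s' t.
Proof. induction t; simpl; intros Ht Hs; f_equal; intuition auto. Qed.

Lemma up_ext_bound n s s' :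
  (forall i, i < n -> s i = s' i) -> forall i, i < S n -> up s i = up s' i.
Proof.
intros Hs [|i] Hi; [reflexivity|]; unfold up; simpl; rewrite Hs; [reflexivity|lia].
Qed.

Lemma subst_ext_bound n s s' p :
  fbound n p -> (forall i, i < n -> s i = s' i) -> subst s p = subst s' p.
Proof.
revert n s s'; induction p; simpl; intros n s s' Hp Hs; f_equal;
  try (destruct Hp; eauto using tsubst_ext_bound; fail);
  eapply IHp; eauto using up_ext_bound.
Qed.

Lemma tsubst_ext s s' t : (forall i, s i = s' i) -> tsubst s t = tsubst s' t.
Proof. destruct (tbound_exists t); eauto using tsubst_ext_bound. Qed.

Lemma subst_ext s s' p : (forall i, s i = s' i) -> subst s p = subst s' p.
Proof. destruct (fbound_exists p); eauto using subst_ext_bound. Qed.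

Lemma tsubst_comp r s t :
  tsubst r (tsubst s t) = tsubst (fun i => tsubst r (s i)) t.
Proof. induction t; simpl; congruence. Qed.

Lemma up_comp r s i :
  tsubst (up r) (up s i) = up (fun j => tsubst r (s j)) i.
Proof.
destruct i as [|i]; [reflexivity|].
unfold up, tshift; simpl; now rewrite !tsubst_comp.
Qed.

Lemma subst_comp r s p :
  subst r (subst s p) = subst (fun i => tsubst r (s i)) p.
Proof.
revert r s; induction p; simpl; intros r s; rewrite ?tsubst_comp; f_equal; auto;
  rewrite IHp; apply subst_ext, up_comp.
Qed.

Lemma tsubst_Var t : tsubst Var t = t.
Proof. induction t; simpl; congruence. Qed.

Lemma up_Var i : up Var i = Var i.
Proof. now destruct i. Qed.

Lemma subst_Var p : subst Var p = p.
Proof.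
induction p; simpl; rewrite ?tsubst_Var; f_equal; auto;
  now rewrite (subst_ext _ Var) by apply up_Var.
Qed.

Lemma subst_id s p : (forall i, s i = Var i) -> subst s p = p.
Proof. intros Hs; rewrite (subst_ext _ Var) by exact Hs; apply subst_Var. Qed.

Lemma tsubst_closed s t : tbound 0 t -> tsubst s t = t.
Proof.
intros Ht; rewrite <- (tsubst_Var t) at 2.
apply tsubst_ext_bound with (1 := Ht); lia.
Qed.

Lemma subst_closed s p : fbound 0 p -> subst s p = p.
Proof.
intros Hp; rewrite <- (subst_Var p) at 2.
apply subst_ext_bound with (1 := Hp); lia.
Qed.

Lemma tsubst_num s k : tsubst s (num k) = num k.
Proof. apply tsubst_closed, tbound_num. Qed.

Lemma tsubst_iter_Succ s k t :
  tsubst s (Nat.iter k Succ t) = Nat.iter k Succ (tsubst s t).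
Proof. induction k as [|k IH]; simpl; congruence. Qed.

Lemma tshift_tsubst s t : tshift (tsubst s t) = tsubst (up s) (tshift t).
Proof. unfold tshift; now rewrite !tsubst_comp. Qed.

Lemma tsubst_scons_tshift t s u : tsubst (scons t s) (tshift u) = tsubst s u.
Proof. unfold tshift; now rewrite tsubst_comp. Qed.

Lemma tshift_inst t u : tsubst (scons u Var) (tshift t) = t.
Proof. rewrite tsubst_scons_tshift; apply tsubst_Var. Qed.

Lemma subst_inst s p t : subst s (inst p t) = inst (subst (up s) p) (tsubst s t).
Proof.
unfold inst; rewrite !subst_comp; apply subst_ext; intros [|i]; [reflexivity|].
symmetry; apply tshift_inst.
Qed.

Lemma subst_scons t s p : subst (scons t s) p = inst (subst (up s) p) t.
Proof.
unfold inst; rewrite subst_comp; apply subst_ext; intros [|i]; [reflexivity|].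
symmetry; apply tshift_inst.
Qed.

Lemma subst_up_shift s p : subst (up s) (shift p) = shift (subst s p).
Proof. unfold shift; now rewrite !subst_comp. Qed.

Lemma inst_shift p t : inst (shift p) t = p.
Proof. unfold inst, shift; rewrite subst_comp; apply subst_Var. Qed.

Lemma iter_up s l i :
  Nat.iter l up s i =
  if i <? l then Var i else tsubst (fun j => Var (j + l)) (s (i - l)).
Proof.
revert i; induction l as [|l IH]; intros i.
- simpl; rewrite Nat.sub_0_r, (tsubst_ext _ Var), tsubst_Var; auto.
- destruct i as [|i]; [reflexivity|].
  change (tshift (Nat.iter l up s i) =
    if i <? l then Var (S i) else tsubst (fun j => Var (j + S l)) (s (i - l))).
  rewrite IH; destruct (i <? l); [reflexivity|].
  unfold tshift; rewrite tsubst_comp; apply tsubst_ext; simpl; auto.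
Qed.

Lemma subst_exn s n p : subst s (exn n p) = exn n (subst (Nat.iter n up s) p).
Proof.
revert s; induction n as [|n IH]; intros s; [reflexivity|].
change (Ex (subst (up s) (exn n p)) =
        Ex (exn n (subst (Nat.iter (S n) up s) p))).
now rewrite IH, <- Nat.iter_succ_r.
Qed.

Lemma tbound_tsubst m n s t :
  tbound n t -> (forall i, i < n -> tbound m (s i)) -> tbound m (tsubst s t).
Proof. induction t; simpl; intuition. Qed.

Lemma tbound_tshift n t : tbound (S n) (tshift t) <-> tbound n t.
Proof. induction t; simpl in *; intuition lia. Qed.

Lemma up_bound m n s :
  (forall i, i < n -> tbound m (s i)) ->
  forall i, i < S n -> tbound (S m) (up s i).
Proof.
intros Hs [|i] Hi; simpl; [lia|].
apply tbound_tshift, Hs; lia.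
Qed.

Lemma fbound_subst m n s p :
  fbound n p -> (forall i, i < n -> tbound m (s i)) -> fbound m (subst s p).
Proof.
revert m n s; induction p; simpl; intros m n s Hp Hs;
  intuition eauto using tbound_tsubst;
  eapply IHp; eauto using up_bound.
Qed.

Lemma fbound_inst n p t : fbound (S n) p -> tbound n t -> fbound n (inst p t).
Proof.
intros Hp Ht; apply fbound_subst with (1 := Hp).
intros [|i] Hi; simpl; [exact Ht|lia].
Qed.

Lemma Delta0_subst s p : Delta0 p -> Delta0 (subst s p).
Proof.
intros Hp; revert s; induction Hp; intros s; cbn [subst]; try constructor; auto.
all: cbn [tsubst up scons]; rewrite <- tshift_tsubst; constructor; auto.
Qed.

Lemma Sigma1_subst s p : Sigma1 p -> Sigma1 (subst s p).
Proof.
intros (n & d & Hd & ->).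
exists n, (subst (Nat.iter n up s) d); auto using Delta0_subst, subst_exn.
Qed.

Definition lift (k i : nat) : term := Var (k + i).

Definition incr : nat -> term := scons (Succ (Var 0)) (lift 1).

(** No explicit substitution below has more than four special values. *)
Ltac pointwise :=
  let i := fresh "i" in intros [|[|[|[|i]]]]; intros; simpl; reflexivity.

Ltac subst_eq :=
  unfold inst, shift; rewrite ?subst_comp; apply subst_ext; pointwise.

(** * Derived rules *)

Section Calculus.
Context {T : form -> Prop}.

Lemma prv_weaken G G' p : incl G G' -> prv T G p -> prv T G' p.
Proof.
assert (incl_both : forall q L L', incl L L' -> @incl form (q :: L) (q :: L')).
{ intros q L L' HL; apply incl_cons; [apply in_eq|now apply incl_tl]. }
intros HG Hp; revert G' HG; induction Hp; intros G' HG.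
- now apply P_Ax.
- apply P_Hyp; auto.
- apply P_ImpI; auto.
- apply P_ImpE with p; auto.
- apply P_AndI; auto.
- apply P_AndE1 with q; auto.
- apply P_AndE2 with p; auto.
- apply P_OrI1; auto.
- apply P_OrI2; auto.
- apply P_OrE with p q; auto.
- apply P_AllI, IHHp, incl_map; assumption.
- apply P_AllE; auto.
- apply P_ExI with t; auto.
- apply P_ExE with p; [auto|apply IHHp2, incl_both, incl_map; assumption].
- apply P_Raa; auto.
- apply P_EqI.
- apply P_EqE with t; auto.
Qed.

Lemma prv_nil G p : T |-- p -> prv T G p.
Proof. apply prv_weaken; intros ? []. Qed.

Lemma prv_weaken1 G q p : prv T G p -> prv T (q :: G) p.
Proof. apply prv_weaken; intros x; simpl; auto. Qed.

Lemma prv_hyp0 G p : prv T (p :: G) p.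
Proof. apply P_Hyp; simpl; auto. Qed.

Lemma prv_exfalso G p : prv T G Bot -> prv T G p.
Proof. intros Hbot; apply P_Raa, prv_weaken1, Hbot. Qed.

Lemma prv_cases G q p : prv T (q :: G) p -> prv T (Neg q :: G) p -> prv T G p.
Proof.
intros Hq Hnq; apply P_Raa.
apply P_ImpE with p; [apply prv_hyp0|].
apply P_ImpE with (Neg q); apply P_ImpI.
- revert Hnq; apply prv_weaken; intros x [->|Hx]; simpl; auto.
- apply P_ImpE with p; [apply prv_weaken1, prv_hyp0|].
  revert Hq; apply prv_weaken; intros x [->|Hx]; simpl; auto.
Qed.

Lemma prv_subst (Tsent : sentences T) s G p :
  prv T G p -> prv T (map (subst s) G) (subst s p).
Proof.
assert (map_up_shift : forall s G,
  map (subst (up s)) (map shift G) = map shift (map (subst s) G)).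
{ intros r L; rewrite !map_map; apply map_ext; intros; apply subst_up_shift. }
intros Hp; revert s; induction Hp; intros s; simpl in *;
  auto using P_ImpI, P_AndI, P_OrI1, P_OrI2, P_EqI.
- rewrite subst_closed by auto; now apply P_Ax.
- apply P_Hyp, in_map; assumption.
- apply P_ImpE with (subst s p); auto.
- apply P_AndE1 with (subst s q); auto.
- apply P_AndE2 with (subst s p); auto.
- apply P_OrE with (subst s p) (subst s q); auto.
- apply P_AllI; rewrite <- map_up_shift; apply IHHp.
- rewrite subst_inst; apply P_AllE, IHHp.
- apply P_ExI with (tsubst s t); rewrite <- subst_inst; apply IHHp.
- apply P_ExE with (subst (up s) p); [apply IHHp1|].
  rewrite <- map_up_shift, <- subst_up_shift; apply IHHp2.
- apply P_Raa, IHHp.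
- rewrite subst_inst; apply P_EqE with (tsubst s t); [apply IHHp1|].
  rewrite <- subst_inst; apply IHHp2.
Qed.

Lemma proves_subst (Tsent : sentences T) s G p : T |-- p -> prv T G (subst s p).
Proof. intros Hp; apply prv_nil, (prv_subst Tsent s _ _ Hp). Qed.

Lemma prv_shift_AllE G p : prv T G (shift (All p)) -> prv T G p.
Proof.
intros Hp; rewrite <- (subst_id (scons (Var 0) (lift 1)) p) by pointwise.
rewrite subst_scons; exact (P_AllE T G _ (Var 0) Hp).
Qed.

Lemma prv_shift_ExI G p : prv T G p -> prv T G (shift (Ex p)).
Proof.
intros Hp; apply (P_ExI T G (subst (up (lift 1)) p) (Var 0)).
rewrite <- subst_scons, subst_id; [exact Hp|pointwise].
Qed.

Lemma alln_I n p : T |-- p -> T |-- alln n p.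
Proof. intros Hp; induction n; [exact Hp|apply P_AllI; assumption]. Qed.

Lemma alln_E (Tsent : sentences T) n p : T |-- alln n p -> T |-- p.
Proof.
induction n as [|n IH]; intros Hp; [exact Hp|].
apply IH, prv_shift_AllE, (proves_subst Tsent), Hp.
Qed.

Lemma exn_mono n p q : T |-- Imp p q -> T |-- Imp (exn n p) (exn n q).
Proof.
intros Hpq; induction n as [|n IH]; [exact Hpq|].
apply P_ImpI; eapply P_ExE; [apply prv_hyp0|].
apply prv_shift_ExI; eapply P_ImpE; [apply prv_nil, IH|apply prv_hyp0].
Qed.

(** * Propositional tautologies *)

Fixpoint pval (v : form -> bool) (p : form) : bool :=
  match p with
  | Bot => false
  | Imp p q => implb (pval v p) (pval v q)
  | And p q => pval v p && pval v q
  | Or p q => pval v p || pval v q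
  | a => v a
  end.

Definition tautology (p : form) : Prop := forall v, pval v p = true.

Fixpoint atoms (p : form) : list form :=
  match p with
  | Bot => []
  | Imp p q | And p q | Or p q => atoms p ++ atoms q
  | a => [a]
  end.

Definition signed (b : bool) (p : form) : form := if b then p else Neg p.

Lemma prv_signed_Imp G a b p q :
  prv T G (signed a p) -> prv T G (signed b q) ->
  prv T G (signed (implb a b) (Imp p q)).
Proof.
destruct a, b; simpl; intros Hp Hq; apply P_ImpI.
- now apply prv_weaken1.
- apply P_ImpE with q; [now apply prv_weaken1|].
  apply P_ImpE with p; [apply prv_hyp0|now apply prv_weaken1].
- now apply prv_weaken1.
- apply prv_exfalso, P_ImpE with p; [now apply prv_weaken1|apply prv_hyp0].
Qed.

Lemma prv_signed_And G a b p q :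
  prv T G (signed a p) -> prv T G (signed b q) ->
  prv T G (signed (a && b) (And p q)).
Proof.
destruct a; simpl; intros Hp Hq.
- destruct b; simpl in *; [now apply P_AndI|].
  apply P_ImpI, P_ImpE with q; [now apply prv_weaken1|].
  eapply P_AndE2, prv_hyp0.
- apply P_ImpI, P_ImpE with p; [now apply prv_weaken1|].
  eapply P_AndE1, prv_hyp0.
Qed.

Lemma prv_signed_Or G a b p q :
  prv T G (signed a p) -> prv T G (signed b q) ->
  prv T G (signed (a || b) (Or p q)).
Proof.
destruct a; simpl; intros Hp Hq; [now apply P_OrI1|].
destruct b; simpl in *; [now apply P_OrI2|].
apply P_ImpI, P_OrE with p q;
  [apply prv_hyp0|apply P_ImpE with p|apply P_ImpE with q];
  auto using prv_weaken1, prv_hyp0.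
Qed.

Lemma prv_signed_pval v G p :
  (forall a, In a (atoms p) -> prv T G (signed (v a) a)) ->
  prv T G (signed (pval v p) p).
Proof.
induction p; simpl; intros Hatoms; try (apply Hatoms; now left).
- apply P_ImpI, prv_hyp0.
- apply prv_signed_Imp; auto using in_or_app.
- apply prv_signed_And; auto using in_or_app.
- apply prv_signed_Or; auto using in_or_app.
Qed.

Lemma form_eq_dec (p q : form) : {p = q} + {p <> q}.
Proof. repeat decide equality. Qed.

Lemma prv_tautology_split p L v G :
  tautology p ->
  (forall a, In a (atoms p) -> In a L \/ prv T G (signed (v a) a)) ->
  prv T G p.
Proof.
intros Hp; revert v G; induction L as [|b L IH]; intros v G Hatoms.
- replace p with (signed (pval v p) p) by now rewrite Hp.
  apply prv_signed_pval; intros a Ha; now destruct (Hatoms a Ha).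
- assert (branch : forall c, prv T (signed c b :: G) p).
  { intros c; apply IH with (fun a => if form_eq_dec a b then c else v a).
    intros a Ha; destruct (form_eq_dec a b) as [->|Hab].
    - right; apply prv_hyp0.
    - destruct (Hatoms a Ha) as [[->|HL]|HG]; [congruence|now left|].
      right; now apply prv_weaken1. }
  apply prv_cases with b; [exact (branch true)|exact (branch false)].
Qed.

Lemma prv_tautology G p : tautology p -> prv T G p.
Proof.
intros Hp; apply prv_tautology_split with (atoms p) (fun _ => true); auto.
Qed.

End Calculus.

Definition ite (c p q : form) : form := Or (And c p) (And (Neg c) q).

Definition decides (c a p q : form) : form :=
  And (Imp c (Iff a p)) (Imp (Neg c) (Iff a q)).

Ltac truth_table :=
  intros v; cbn [pval Neg Iff ite decides];
  repeat match goal with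
  | |- context [pval v ?p] => destruct (pval v p)
  | |- context [v ?a] => destruct (v a)
  end;
  reflexivity.

Tactic Notation "taut" := apply prv_tautology; truth_table.
Tactic Notation "taut" constr(Hp) := refine (P_ImpE _ _ _ _ _ Hp); taut.
Tactic Notation "taut" constr(Hp) constr(Hq) :=
  refine (P_ImpE _ _ _ _ _ Hp); taut Hq.
Tactic Notation "taut" constr(Hp) constr(Hq) constr(Hr) :=
  refine (P_ImpE _ _ _ _ _ Hp); taut Hq Hr.
Tactic Notation "taut" constr(Hp) constr(Hq) constr(Hr) constr(Hs) :=
  refine (P_ImpE _ _ _ _ _ Hp); taut Hq Hr Hs.

Section IffEquality.
Context {T : form -> Prop}.

Lemma iff_refl G p : prv T G (Iff p p).
Proof. taut. Qed.

Lemma iff_sym G p q : prv T G (Iff p q) -> prv T G (Iff q p).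
Proof. intros Hpq; taut Hpq. Qed.

Lemma iff_trans G p q r :
  prv T G (Iff p q) -> prv T G (Iff q r) -> prv T G (Iff p r).
Proof. intros Hpq Hqr; taut Hpq Hqr. Qed.

Lemma prv_iff G p q : prv T G (Iff p q) -> prv T G p -> prv T G q.
Proof. intros Hpq Hp; taut Hpq Hp. Qed.

Lemma prv_eq_subst G t u s p :
  prv T G (Eq t u) -> prv T G (subst (scons t s) p) ->
  prv T G (subst (scons u s) p).
Proof. rewrite !subst_scons; apply P_EqE. Qed.

Lemma prv_eq_sym G t u : prv T G (Eq t u) -> prv T G (Eq u t).
Proof.
intros Heq; apply (prv_eq_subst G t u (fun _ => t) (Eq (Var 0) (Var 1)) Heq).
apply P_EqI.
Qed.

Lemma prv_eq_trans G t u w :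
  prv T G (Eq t u) -> prv T G (Eq u w) -> prv T G (Eq t w).
Proof.
intros Etu Euw.
exact (prv_eq_subst G u w (fun _ => t) (Eq (Var 1) (Var 0)) Euw Etu).
Qed.

Lemma prv_eq_iff G t u s p :
  prv T G (Eq t u) ->
  prv T G (Iff (subst (scons t s) p) (subst (scons u s) p)).
Proof.
intros Heq; apply P_AndI; apply P_ImpI; eapply prv_eq_subst.
1: apply prv_weaken1; exact Heq.
2: apply prv_weaken1, prv_eq_sym; exact Heq.
all: apply prv_hyp0.
Qed.

Lemma prv_eq_tsubst G t u s w :
  prv T G (Eq t u) ->
  prv T G (Eq (tsubst (scons t s) w) (tsubst (scons u s) w)).
Proof.
intros Htu; set (w0 := tsubst (scons t s) w).
assert (instance : forall x, subst (scons x Var)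
  (Eq (tshift w0) (tsubst (scons (Var 0) (fun i => tshift (s i))) w)) =
  Eq w0 (tsubst (scons x s) w)).
{ intros x; simpl; rewrite tshift_inst, tsubst_comp; f_equal.
  apply tsubst_ext; intros [|i]; [reflexivity|apply tshift_inst]. }
rewrite <- instance; apply prv_eq_subst with (1 := Htu); rewrite instance.
apply P_EqI.
Qed.

Lemma prv_eq_succ G t u : prv T G (Eq t u) -> prv T G (Eq (Succ t) (Succ u)).
Proof. exact (prv_eq_tsubst G t u Var (Succ (Var 0))). Qed.

Lemma prv_eq_add G t u t' u' :
  prv T G (Eq t t') -> prv T G (Eq u u') -> prv T G (Eq (Add t u) (Add t' u')).
Proof.
intros Et Eu; apply prv_eq_trans with (Add t' u).
- exact (prv_eq_tsubst G t t' (fun _ => u) (Add (Var 0) (Var 1)) Et).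
- exact (prv_eq_tsubst G u u' (fun _ => t') (Add (Var 1) (Var 0)) Eu).
Qed.

Lemma prv_eq_mul G t u t' u' :
  prv T G (Eq t t') -> prv T G (Eq u u') -> prv T G (Eq (Mul t u) (Mul t' u')).
Proof.
intros Et Eu; apply prv_eq_trans with (Mul t' u).
- exact (prv_eq_tsubst G t t' (fun _ => u) (Mul (Var 0) (Var 1)) Et).
- exact (prv_eq_tsubst G u u' (fun _ => t') (Mul (Var 1) (Var 0)) Eu).
Qed.

End IffEquality.

(** * Arithmetic in extensions of PA *)

Class extends_PA (T : form -> Prop) : Prop := {
  extends_PA_sentences : sentences T;
  extends_PA_stronger : stronger T PA
}.

Lemma sentences_PA : sentences PA.
Proof.
intros _ [| | | | | | |n p Hp]; simpl; try lia.
apply fbound_alln; rewrite Nat.add_0_r; simpl.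
repeat split; try assumption; [apply fbound_inst; simpl; auto|].
apply fbound_subst with (1 := Hp); intros [|i] Hi; simpl; lia.
Qed.

#[local] Instance extends_PA_PA : extends_PA PA.
Proof. split; [exact sentences_PA|exact (fun p Hp => Hp)]. Qed.

Lemma ce_extension_extends_PA T : ce_extension_of_PA T -> extends_PA T.
Proof. now intros (? & _ & ?). Qed.

Section Arithmetic.
Context {T : form -> Prop} {TPA : extends_PA T}.

Lemma PA_instance s G p : PA |-- p -> prv T G (subst s p).
Proof.
intros Hp; apply proves_subst; [apply TPA|]; now apply extends_PA_stronger.
Qed.

Lemma PA_alln_instance n s G p : PA (alln n p) -> prv T G (subst s p).
Proof.
intros Hp; apply PA_instance, (alln_E sentences_PA n), P_Ax, Hp.
Qed.

Lemma prv_succ_neq0 G t : prv T G (Neg (Eq (Succ t) Zero)).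
Proof. exact (PA_alln_instance 1 (fun _ => t) G _ PA_succ0). Qed.

Lemma prv_succ_inj G t u :
  prv T G (Eq (Succ t) (Succ u)) -> prv T G (Eq t u).
Proof.
apply P_ImpE; exact (PA_alln_instance 2 (scons u (fun _ => t)) G _ PA_succ_inj).
Qed.

Lemma prv_add0 G t : prv T G (Eq (Add t Zero) t).
Proof. exact (PA_alln_instance 1 (fun _ => t) G _ PA_add0). Qed.

Lemma prv_addS G t u : prv T G (Eq (Add t (Succ u)) (Succ (Add t u))).
Proof. exact (PA_alln_instance 2 (scons u (fun _ => t)) G _ PA_addS). Qed.

Lemma prv_mul0 G t : prv T G (Eq (Mul t Zero) Zero).
Proof. exact (PA_alln_instance 1 (fun _ => t) G _ PA_mul0). Qed.

Lemma prv_mulS G t u : prv T G (Eq (Mul t (Succ u)) (Add (Mul t u) t)).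
Proof. exact (PA_alln_instance 2 (scons u (fun _ => t)) G _ PA_mulS). Qed.

Lemma prv_le_def G t u :
  prv T G (Iff (Le t u) (Ex (Eq (Add (Var 0) (tshift t)) (tshift u)))).
Proof. exact (PA_alln_instance 2 (scons u (fun _ => t)) G _ PA_le). Qed.

Lemma prv_leI G c t u : prv T G (Eq (Add c t) u) -> prv T G (Le t u).
Proof.
intros Heq; eapply prv_iff; [apply iff_sym, prv_le_def|]; apply P_ExI with c.
unfold inst; simpl; now rewrite !tshift_inst.
Qed.

Lemma prv_leE G t u q :
  prv T G (Le t u) ->
  prv T (Eq (Add (Var 0) (tshift t)) (tshift u) :: map shift G) (shift q) ->
  prv T G q.
Proof. intros Htu; apply P_ExE, prv_iff with (2 := Htu), prv_le_def. Qed.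

Lemma prv_induction G p :
  prv T G (inst p Zero) -> prv T (p :: map shift G) (subst incr p) ->
  prv T G (All p).
Proof.
intros Hbase Hstep; destruct (fbound_exists p) as [n Hn].
assert (Hind : prv T G (induction p)).
{ rewrite <- (subst_Var (induction p)); apply PA_alln_instance with n.
  apply PA_induct, fbound_mono with n; auto. }
eapply P_ImpE; [eapply P_ImpE; [exact Hind|exact Hbase]|].
apply P_AllI, P_ImpI, Hstep.
Qed.

Lemma proves_induction p :
  T |-- inst p Zero -> prv T [p] (subst incr p) -> T |-- p.
Proof.
intros Hbase Hstep; apply (alln_E extends_PA_sentences 1).
now apply prv_induction.
Qed.

(** The parameter [Var 1], which the induction hypothesis changes to [w], is
    universally quantified in the induction formula. *)
Lemma proves_induction_parameter w p :
  T |-- inst p Zero ->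
  prv T [subst (scons (Var 0) (scons w (lift 2))) p] (subst incr p) ->
  T |-- p.
Proof.
intros Hbase Hstep.
set (h := scons (Var 0) (scons w (lift 2))) in Hstep.
set (swap := scons (Var 1) (scons (Var 0) (lift 2))).
assert (all_p : T |-- All (subst swap p)).
{ apply proves_induction; unfold inst; cbn [subst]; apply P_AllI.
  - replace (subst (up (scons Zero Var)) (subst swap p)) with (inst p Zero)
      by subst_eq.
    exact Hbase.
  - replace (subst (up incr) (subst swap p)) with (subst swap (subst incr p))
      by subst_eq.
    apply P_ImpE with (subst swap (subst h p)).
    + apply (proves_subst extends_PA_sentences swap _
        (Imp (subst h p) (subst incr p))).
      now apply P_ImpI.
    + replace (subst swap (subst h p))
        with (inst (subst (up (lift 1)) (subst swap p)) (tsubst swap w))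
        by subst_eq.
      exact (P_AllE T _ (subst (up (lift 1)) (subst swap p)) _ (prv_hyp0 _ _)). }
rewrite <- (subst_id (fun i => tsubst swap (swap i)) p) by pointwise.
rewrite <- subst_comp; apply proves_subst; [apply TPA|].
now apply (alln_E extends_PA_sentences 1).
Qed.

Lemma prv_0add G t : prv T G (Eq (Add Zero t) t).
Proof.
apply (proves_subst extends_PA_sentences (fun _ => t) G
  (Eq (Add Zero (Var 0)) (Var 0))).
apply proves_induction; [apply prv_add0|]; simpl.
eapply prv_eq_trans; [apply prv_addS|apply prv_eq_succ, prv_hyp0].
Qed.

Lemma prv_Sadd G t u : prv T G (Eq (Add (Succ t) u) (Succ (Add t u))).
Proof.
apply (proves_subst extends_PA_sentences (scons u (fun _ => t)) G
  (Eq (Add (Succ (Var 1)) (Var 0)) (Succ (Add (Var 1) (Var 0))))).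
apply proves_induction; simpl.
- eapply prv_eq_trans; [apply prv_add0|].
  apply prv_eq_sym, prv_eq_succ, prv_add0.
- eapply prv_eq_trans; [apply prv_addS|apply prv_eq_succ].
  eapply prv_eq_trans; [apply prv_hyp0|apply prv_eq_sym, prv_addS].
Qed.

Lemma prv_add_comm G t u : prv T G (Eq (Add t u) (Add u t)).
Proof.
apply (proves_subst extends_PA_sentences (scons u (fun _ => t)) G
  (Eq (Add (Var 1) (Var 0)) (Add (Var 0) (Var 1)))).
apply proves_induction; simpl.
- eapply prv_eq_trans; [apply prv_add0|apply prv_eq_sym, prv_0add].
- eapply prv_eq_trans; [apply prv_addS|].
  eapply prv_eq_trans; [apply prv_eq_succ, prv_hyp0|apply prv_eq_sym, prv_Sadd].
Qed.

Lemma prv_add_assoc G t u w :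
  prv T G (Eq (Add (Add t u) w) (Add t (Add u w))).
Proof.
apply (proves_subst extends_PA_sentences (scons w (scons u (fun _ => t))) G
  (Eq (Add (Add (Var 2) (Var 1)) (Var 0)) (Add (Var 2) (Add (Var 1) (Var 0))))).
apply proves_induction; simpl.
- eapply prv_eq_trans; [apply prv_add0|apply prv_eq_sym].
  apply prv_eq_add; [apply P_EqI|apply prv_add0].
- eapply prv_eq_trans; [apply prv_addS|].
  eapply prv_eq_trans; [apply prv_eq_succ, prv_hyp0|].
  eapply prv_eq_trans; [apply prv_eq_sym, prv_addS|].
  apply prv_eq_add; [apply P_EqI|apply prv_eq_sym, prv_addS].
Qed.

Lemma prv_addS_Sadd G t u :
  prv T G (Eq (Add t (Succ u)) (Add (Succ t) u)).
Proof. eapply prv_eq_trans; [apply prv_addS|apply prv_eq_sym, prv_Sadd]. Qed.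

Lemma prv_mul0_add G x u : prv T G (Eq (Add (Mul x Zero) u) u).
Proof.
eapply prv_eq_trans; [apply prv_eq_add; [apply prv_mul0|apply P_EqI]|].
apply prv_0add.
Qed.

Lemma prv_mulS_add G x y u :
  prv T G (Eq (Add (Mul x (Succ y)) u) (Add (Mul x y) (Add u x))).
Proof.
eapply prv_eq_trans; [apply prv_eq_add; [apply prv_mulS|apply P_EqI]|].
eapply prv_eq_trans; [apply prv_add_assoc|].
apply prv_eq_add; [apply P_EqI|apply prv_add_comm].
Qed.

Lemma prv_add_num G a b : prv T G (Eq (Add (num a) (num b)) (num (a + b))).
Proof.
rewrite Nat.add_comm; induction b as [|b IH]; [apply prv_add0|].
eapply prv_eq_trans; [apply prv_addS|apply prv_eq_succ, IH].
Qed.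

Lemma prv_mul_num G a b : prv T G (Eq (Mul (num a) (num b)) (num (a * b))).
Proof.
induction b as [|b IH].
- rewrite Nat.mul_0_r; apply prv_mul0.
- rewrite Nat.mul_succ_r.
  eapply prv_eq_trans; [apply prv_mulS|].
  eapply prv_eq_trans; [apply prv_eq_add; [apply IH|apply P_EqI]|].
  apply prv_add_num.
Qed.

Lemma prv_eq_num_teval G v t :
  tbound 0 t -> prv T G (Eq t (num (teval v t))).
Proof.
induction t as [i| |t IH|t IHt u IHu|t IHt u IHu]; simpl; intros Ht.
- lia.
- apply P_EqI.
- apply prv_eq_succ, IH, Ht.
- destruct Ht; eapply prv_eq_trans; [|apply prv_add_num].
  apply prv_eq_add; auto.
- destruct Ht; eapply prv_eq_trans; [|apply prv_mul_num].
  apply prv_eq_mul; auto.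
Qed.

Lemma prv_0le G t : prv T G (Le Zero t).
Proof. apply prv_leI with t, prv_add0. Qed.

Lemma prv_le_refl G t : prv T G (Le t t).
Proof. apply prv_leI with Zero, prv_0add. Qed.

Lemma prv_succ_nle0 G t : prv T G (Neg (Le (Succ t) Zero)).
Proof.
apply P_ImpI; eapply prv_leE; [apply prv_hyp0|].
eapply P_ImpE; [apply prv_succ_neq0|].
eapply prv_eq_trans; [apply prv_eq_sym, prv_addS|apply prv_hyp0].
Qed.

Lemma prv_le_succ_succ G t u : prv T G (Iff (Le (Succ t) (Succ u)) (Le t u)).
Proof.
apply P_AndI; apply P_ImpI; (eapply prv_leE; [apply prv_hyp0|]).
- apply prv_leI with (Var 0), prv_succ_inj.
  eapply prv_eq_trans; [apply prv_eq_sym, prv_addS|apply prv_hyp0].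
- apply prv_leI with (Var 0).
  eapply prv_eq_trans; [apply prv_addS|apply prv_eq_succ, prv_hyp0].
Qed.

Lemma prv_le_succ G t u : prv T G (Le t u) -> prv T G (Le t (Succ u)).
Proof.
intros Htu; apply prv_leE with (1 := Htu), prv_leI with (Succ (Var 0)).
eapply prv_eq_trans; [apply prv_Sadd|apply prv_eq_succ, prv_hyp0].
Qed.

Lemma prv_le_cases G t u :
  prv T G (Le t u) -> prv T G (Or (Eq t u) (Le (Succ t) u)).
Proof.
intros Htu; apply prv_leE with (1 := Htu); eapply P_ImpE; [|apply prv_hyp0].
apply (proves_subst extends_PA_sentences
  (scons (Var 0) (scons (tshift t) (fun _ => tshift u))) _
  (Imp (Eq (Add (Var 0) (Var 1)) (Var 2))
       (Or (Eq (Var 1) (Var 2)) (Le (Succ (Var 1)) (Var 2))))).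
apply proves_induction; [|apply prv_weaken1]; simpl; apply P_ImpI.
- apply P_OrI1; eapply prv_eq_trans; [apply prv_eq_sym, prv_0add|apply prv_hyp0].
- apply P_OrI2, prv_leI with (Var 0).
  eapply prv_eq_trans; [apply prv_addS_Sadd|apply prv_hyp0].
Qed.

Lemma prv_le0 G t : prv T G (Le t Zero) -> prv T G (Eq t Zero).
Proof. intros Ht; taut (prv_le_cases G t Zero Ht) (prv_succ_nle0 G t). Qed.

Lemma prv_leS G t u :
  prv T G (Le t (Succ u)) -> prv T G (Or (Le t u) (Eq t (Succ u))).
Proof.
intros Htu; taut (prv_le_cases G t (Succ u) Htu) (prv_le_succ_succ G t u).
Qed.

Lemma prv_le_total G t u : prv T G (Or (Le t u) (Le (Succ u) t)).
Proof.
apply (proves_subst extends_PA_sentences (scons t (fun _ => u)) G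
  (Or (Le (Var 0) (Var 1)) (Le (Succ (Var 1)) (Var 0)))).
apply proves_induction; simpl; [apply P_OrI1, prv_0le|].
eapply P_OrE; [apply prv_hyp0| |].
- eapply P_OrE; [apply prv_le_cases, prv_hyp0| |].
  + apply P_OrI2, prv_leI with Zero.
    eapply prv_eq_trans; [apply prv_0add|].
    apply prv_eq_succ, prv_eq_sym, prv_hyp0.
  + apply P_OrI1, prv_hyp0.
- apply P_OrI2, prv_le_succ, prv_hyp0.
Qed.

Lemma prv_succ_nle G t : prv T G (Neg (Le (Succ t) t)).
Proof.
apply (proves_subst extends_PA_sentences (fun _ => t) G
  (Neg (Le (Succ (Var 0)) (Var 0)))).
apply proves_induction; simpl; [apply prv_succ_nle0|].
apply prv_iff with (2 := prv_hyp0 _ _).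
taut (prv_le_succ_succ [Neg (Le (Succ (Var 0)) (Var 0))] (Succ (Var 0)) (Var 0)).
Qed.

Lemma prv_add_succ_nle G t u : prv T G (Neg (Le (Add t (Succ u)) u)).
Proof.
apply P_ImpI; eapply prv_leE; [apply prv_hyp0|].
eapply P_ImpE; [apply prv_succ_nle|].
apply prv_leI with (Add (Var 0) (tshift t)).
eapply prv_eq_trans; [apply prv_add_assoc|apply prv_hyp0].
Qed.

Lemma prv_eq_not_lt G t u : prv T G (Eq t u) -> prv T G (Neg (Le (Succ t) u)).
Proof.
intros Heq; apply (prv_eq_subst G t u (fun _ => t)
  (Neg (Le (Succ (Var 1)) (Var 0))) Heq), prv_succ_nle.
Qed.

Lemma prv_not_lt_iff_eq G t u :
  prv T G (Iff (And (Neg (Le (Succ t) u)) (Neg (Le (Succ u) t))) (Eq t u)).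
Proof.
apply P_AndI.
- assert (le_cases : prv T G (Imp (Le t u) (Or (Eq t u) (Le (Succ t) u)))).
  { apply P_ImpI, prv_le_cases, prv_hyp0. }
  taut (prv_le_total G t u) le_cases.
- apply P_ImpI, P_AndI; apply prv_eq_not_lt; [|apply prv_eq_sym]; apply prv_hyp0.
Qed.

(** * Bounded quantifiers *)

Definition ball (t : term) (p : form) : form :=
  All (Imp (Le (Var 0) (tshift t)) p).

Definition bex (t : term) (p : form) : form :=
  Ex (And (Le (Var 0) (tshift t)) p).

Lemma prv_ballE G t p u :
  prv T G (ball t p) -> prv T G (Le u t) -> prv T G (inst p u).
Proof.
intros Hp; apply P_ImpE.
generalize (P_AllE T G _ u Hp); unfold inst; simpl; now rewrite tshift_inst.
Qed.

Lemma prv_shift_ballE G t p :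
  prv T G (shift (ball t p)) -> prv T G (Le (Var 0) (tshift t)) -> prv T G p.
Proof. intros Hp; apply P_ImpE, prv_shift_AllE, Hp. Qed.

Lemma prv_eq_inst G t p :
  prv T G (Eq (Var 0) (tshift t)) -> prv T G (shift (inst p t)) -> prv T G p.
Proof.
intros Heq Hp; rewrite <- (subst_id (scons (Var 0) (lift 1)) p) by pointwise.
apply prv_eq_subst with (tshift t); [now apply prv_eq_sym|].
unfold shift, inst in Hp; rewrite subst_comp in Hp.
now rewrite (subst_ext _ (fun i => tsubst (lift 1) (scons t Var i)))
  by now intros [].
Qed.

Lemma prv_ball0 G p : prv T G (Iff (ball Zero p) (inst p Zero)).
Proof.
apply P_AndI; apply P_ImpI.
- apply prv_ballE with Zero; [apply prv_hyp0|apply prv_0le].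
- apply P_AllI, P_ImpI, prv_eq_inst with Zero.
  + apply prv_le0, prv_hyp0.
  + apply prv_weaken1, prv_hyp0.
Qed.

Lemma prv_ballS G t p :
  prv T G (Iff (ball (Succ t) p) (And (ball t p) (inst p (Succ t)))).
Proof.
apply P_AndI; apply P_ImpI; [apply P_AndI|].
- apply P_AllI, P_ImpI, prv_shift_ballE with (Succ t).
  + apply prv_weaken1, prv_hyp0.
  + apply prv_le_succ, prv_hyp0.
- apply prv_ballE with (Succ t); [apply prv_hyp0|apply prv_le_refl].
- apply P_AllI, P_ImpI.
  eapply P_OrE; [apply prv_leS, prv_hyp0| |].
  + apply prv_shift_ballE with t; [|apply prv_hyp0].
    do 2 apply prv_weaken1; eapply P_AndE1, prv_hyp0.
  + apply prv_eq_inst with (Succ t); [apply prv_hyp0|].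
    do 2 apply prv_weaken1; eapply P_AndE2, prv_hyp0.
Qed.

Lemma prv_bex_ball G t p : prv T G (Iff (bex t p) (Neg (ball t (Neg p)))).
Proof.
apply P_AndI; apply P_ImpI.
- apply P_ImpI; eapply P_ExE; [apply prv_weaken1, prv_hyp0|].
  apply P_ImpE with p; [|eapply P_AndE2, prv_hyp0].
  apply prv_shift_ballE with t; [|eapply P_AndE1, prv_hyp0].
  apply prv_weaken1, prv_hyp0.
- apply P_Raa; apply P_ImpE with (ball t (Neg p)); [apply prv_weaken1, prv_hyp0|].
  apply P_AllI, P_ImpI, P_ImpI.
  apply P_ImpE with (shift (bex t p)); [do 2 apply prv_weaken1; apply prv_hyp0|].
  apply prv_shift_ExI, P_AndI; [apply prv_weaken1|]; apply prv_hyp0.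
Qed.

End Arithmetic.

(** * Substitution in dotted formulas *)

(** The substitutions that commute with [gdot] on the nose: a numeral, or
    successors of a dotted variable, put for a dotted variable are absorbed by
    the numeral that the variable stands for. *)
Definition dotted (m n : nat) (r : nat -> term) : Prop :=
  (forall i, i < n ->
    exists k, r i = num k \/ exists j, j < m /\ r i = Nat.iter k Succ (Var j)) /\
  (forall i, r (n + i) = Var (m + i)).

Lemma dotted_Var n : dotted n n Var.
Proof. split; [intros i Hi; exists 0; right; now exists i|reflexivity]. Qed.

Lemma dotted_lift m n k : m = k + n -> dotted m n (lift k).
Proof.
intros ->; split; intros i.
- intros Hi; exists 0; right; exists (k + i); split; [lia|reflexivity].
- unfold lift; f_equal; lia.
Qed.

Lemma dotted_scons_Zero m n r : dotted m n r -> dotted m (S n) (scons Zero r).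
Proof.
intros [Hr Hpar]; split; [|exact Hpar].
intros [|i] Hi; [exists 0; now left|apply Hr; lia].
Qed.

Lemma dotted_scons_Var m n j r :
  j < m -> dotted m n r -> dotted m (S n) (scons (Var j) r).
Proof.
intros Hj [Hr Hpar]; split; [|exact Hpar].
intros [|i] Hi; [exists 0; right; now exists j|apply Hr; lia].
Qed.

Lemma dotted_scons_Succ_Var m n j r :
  j < m -> dotted m n r -> dotted m (S n) (scons (Succ (Var j)) r).
Proof.
intros Hj [Hr Hpar]; split; [|exact Hpar].
intros [|i] Hi; [exists 1; right; now exists j|apply Hr; lia].
Qed.

Ltac dotted_tac :=
  unfold incr; cbn [Nat.add];
  repeat first
    [ apply dotted_scons_Zero
    | apply dotted_scons_Var; [lia|]
    | apply dotted_scons_Succ_Var; [lia|]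
    | apply dotted_Var
    | apply dotted_lift; lia ].

Lemma tsubst_tpair s a b :
  tsubst s (tpair a b) = tpair (tsubst s a) (tsubst s b).
Proof. reflexivity. Qed.

Lemma gdot_term_iter_Succ n l k j t :
  gdot_term n l k (Nat.iter j Succ t) = gdot_term n l (j + k) t.
Proof.
revert k; induction j as [|j IH]; intros k; [reflexivity|].
change (gdot_term n l (S k) (Nat.iter j Succ t) = gdot_term n l (S j + k) t).
rewrite IH; f_equal; lia.
Qed.

Lemma gdot_term_subst_Var m n r l k i :
  dotted m n r ->
  gdot_term m l k (Nat.iter l up r i) = tsubst r (gdot_term n l k (Var i)).
Proof.
intros [Hr Hpar]; cbn [gdot_term]; rewrite iter_up.
destruct (Nat.ltb_spec i l) as [Hl|Hl].
{ cbn [gdot_term]; destruct (Nat.ltb_spec i l); [|lia].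
  now rewrite tsubst_tpair, !tsubst_num. }
destruct (Nat.ltb_spec i (l + n)) as [Hn|Hn].
- rewrite tsubst_tpair, tsubst_num, tsubst_iter_Succ; cbn [tsubst].
  destruct (Hr (i - l)) as [j [->|[x [Hx ->]]]]; [lia| |].
  + rewrite tsubst_num; unfold num; rewrite gdot_term_iter_Succ.
    now rewrite <- Nat.iter_add, (Nat.add_comm k j).
  + rewrite tsubst_iter_Succ, gdot_term_iter_Succ; cbn [gdot_term tsubst].
    destruct (Nat.ltb_spec (x + l) l); [lia|].
    destruct (Nat.ltb_spec (x + l) (l + m)); [|lia].
    now rewrite <- Nat.iter_add, (Nat.add_comm k j), Nat.add_sub.
- replace (i - l) with (n + (i - l - n)) by lia; rewrite Hpar.
  cbn [gdot_term tsubst].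
  destruct (Nat.ltb_spec (m + (i - l - n) + l) l); [lia|].
  destruct (Nat.ltb_spec (m + (i - l - n) + l) (l + m)); [lia|].
  rewrite tsubst_tpair, !tsubst_num; do 3 f_equal; lia.
Qed.

Lemma gdot_term_subst m n r l k t :
  dotted m n r ->
  gdot_term m l k (tsubst (Nat.iter l up r) t) = tsubst r (gdot_term n l k t).
Proof.
intros Hr; revert k; induction t; intros k; [now apply gdot_term_subst_Var| | | |];
  cbn [gdot_term tsubst]; rewrite ?tsubst_tpair, ?tsubst_num, ?IHt1, ?IHt2; auto.
Qed.

Lemma gdot_subst m n r p :
  dotted m n r -> gdot m (subst r p) = tsubst r (gdot n p).
Proof.
intros Hr; unfold gdot; change r with (Nat.iter 0 up r) at 1.
generalize 0 as l; induction p; intros l; cbn [gdot_form subst];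
  change (up (Nat.iter l up r)) with (Nat.iter (S l) up r);
  rewrite ?IHp1, ?IHp2, ?IHp, ?tsubst_tpair, ?tsubst_num,
    ?(gdot_term_subst m n r) by exact Hr; reflexivity.
Qed.

(** * Dotted provability *)

Section Provability.
Context {U T : form -> Prop} {UPA : extends_PA U} {TPA : extends_PA T}.
Variable Pr : form.
Hypotheses (Pr_bound : fbound 1 Pr) (Pr_EU : cond_EU U T Pr).

(** [Pr] of the quotation of p with the terms [s 0], ..., [s (n-1)] put for the
    dotted variables outside the quotation: the numerals of the values of these
    terms are what is substituted in p. *)
Definition PrDot (s : nat -> term) (n : nat) (p : form) : form :=
  inst Pr (tsubst s (gdot n p)).

Lemma PrDot_Var n p : PrDot Var n p = inst Pr (gdot n p).
Proof. unfold PrDot; now rewrite tsubst_Var. Qed.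

Lemma PrDot_ext s s' n p :
  (forall i, i < n -> s i = s' i) -> PrDot s n p = PrDot s' n p.
Proof.
intros Hs; unfold PrDot; f_equal.
apply tsubst_ext_bound with (2 := Hs), gdot_bound.
Qed.

Lemma subst_PrDot r s n p :
  subst r (PrDot s n p) = PrDot (fun i => tsubst r (s i)) n p.
Proof.
unfold PrDot; rewrite <- tsubst_comp; unfold inst; rewrite subst_comp.
apply subst_ext_bound with (1 := Pr_bound); intros [|i] Hi; [reflexivity|lia].
Qed.

Lemma PrDot_subst s m n r p :
  dotted m n r ->
  PrDot s m (subst r p) = PrDot (fun i => tsubst s (r i)) n p.
Proof.
intros Hr; unfold PrDot; now rewrite (gdot_subst m n r p Hr), tsubst_comp.
Qed.

Lemma PrDot_shift s n p :
  PrDot s (1 + n) (shift p) = PrDot (fun i => s (S i)) n p.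
Proof. apply (PrDot_subst s (1 + n) n (lift 1)); dotted_tac. Qed.

Lemma shift_PrDot s n p : shift (PrDot s n p) = PrDot (up s) (1 + n) (shift p).
Proof. rewrite PrDot_shift; apply subst_PrDot. Qed.

Lemma PrDot_iff G s n p q :
  T |-- Iff p q -> prv U G (Iff (PrDot s n p) (PrDot s n q)).
Proof.
intros Hpq; apply (alln_I n), Pr_EU, (alln_E extends_PA_sentences) in Hpq.
rewrite <- !PrDot_Var in Hpq.
apply (proves_subst extends_PA_sentences s G) in Hpq.
cbn [subst Iff] in Hpq; rewrite !subst_PrDot in Hpq; exact Hpq.
Qed.

Lemma PrDot_eq G s n t u p :
  prv U G (Eq t u) ->
  prv U G (Iff (PrDot (scons t s) n p) (PrDot (scons u s) n p)).
Proof.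
intros Heq; apply (prv_eq_iff G t u s (PrDot Var n p)) in Heq.
rewrite !subst_PrDot in Heq; exact Heq.
Qed.

Lemma PrDot_0 G s p : prv U G (Iff (PrDot s 0 p) (inst Pr (quote p))).
Proof.
rewrite (PrDot_ext s Var) by lia; rewrite PrDot_Var; apply prv_eq_iff.
unfold quote; replace (gform p) with (teval (fun _ => 0) (gdot 0 p)).
- apply prv_eq_num_teval, gdot_bound.
- rewrite gdot_spec, subst_id; [reflexivity|].
  intros i; unfold num_subst; simpl; f_equal; lia.
Qed.

(** [track m n r p s] says that the [n] dotted variables of [p] may be replaced
    by the terms [r 0], ..., [r (n-1)] in [m] dotted variables with values [s]
    inside the quotation as well as outside. *)
Definition track (m n : nat) (r : nat -> term) (p : form) (s : nat -> term) :
  form :=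
  Iff (PrDot s m (subst r p)) (PrDot (fun i => tsubst s (r i)) n p).

Definition tracked (m n : nat) (r : nat -> term) : Prop :=
  forall p G s, prv U G (track m n r p s).

Lemma subst_track q m n r p s :
  subst q (track m n r p s) = track m n r p (fun i => tsubst q (s i)).
Proof.
unfold track, Iff; cbn [subst]; rewrite !subst_PrDot.
rewrite (PrDot_ext (fun i => tsubst q (tsubst s (r i)))
  (fun i => tsubst (fun j => tsubst q (s j)) (r i)))
  by (intros i _; apply tsubst_comp).
reflexivity.
Qed.

Lemma track_ext m n r r' p s s' :
  (forall i, r i = r' i) -> (forall i, s i = s' i) ->
  track m n r p s = track m n r' p s'.
Proof.
intros Hr Hs; unfold track.
rewrite (subst_ext r r' p Hr), (PrDot_ext s s' m) by auto; f_equal.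
apply PrDot_ext; intros i _; rewrite Hr; now apply tsubst_ext.
Qed.

Lemma tracked_ext m n r r' :
  (forall i, r i = r' i) -> tracked m n r -> tracked m n r'.
Proof.
intros Hr Htr p G s; rewrite (track_ext m n r' r p s s) by auto; apply Htr.
Qed.

Lemma dotted_tracked m n r : dotted m n r -> tracked m n r.
Proof.
intros Hr p G s; unfold track; rewrite (PrDot_subst s m n r p Hr); apply iff_refl.
Qed.

Lemma track_comp k m n q r p G s :
  tracked k m q ->
  prv U G (Iff (track k n (fun i => tsubst q (r i)) p s)
               (track m n r p (fun i => tsubst s (q i)))).
Proof.
intros Hq; specialize (Hq (subst r p) G s); unfold track in *.
rewrite subst_comp in Hq.
rewrite (PrDot_ext (fun i => tsubst s (tsubst q (r i)))
  (fun i => tsubst (fun j => tsubst s (q j)) (r i)))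
  by (intros i _; apply tsubst_comp).
taut Hq.
Qed.

Lemma tracked_comp k m n q r :
  tracked k m q -> tracked m n r -> tracked k n (fun i => tsubst q (r i)).
Proof.
intros Hq Hr p G s; eapply prv_iff; [apply iff_sym, track_comp, Hq|apply Hr].
Qed.

Lemma track_eq m n t u r p G s :
  PA |-- Eq t u ->
  prv U G (Iff (track m n (scons t r) p s) (track m n (scons u r) p s)).
Proof.
intros Heq; unfold track.
assert (inner : prv U G (Iff (PrDot s m (subst (scons t r) p))
                             (PrDot s m (subst (scons u r) p)))).
{ apply PrDot_iff, prv_eq_iff; rewrite <- (subst_Var (Eq t u)).
  now apply PA_instance. }
pose proof (PrDot_eq G (fun i => tsubst s (r i)) n _ _ p (PA_instance s G _ Heq))
  as outer.
assert (scons_comp : forall w, PrDot (fun i => tsubst s (scons w r i)) n p =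
  PrDot (scons (tsubst s w) (fun i => tsubst s (r i))) n p).
{ intros w; apply PrDot_ext; pointwise. }
rewrite !scons_comp; taut inner outer.
Qed.

Lemma tracked_eq m n t u r :
  PA |-- Eq t u -> tracked m n (scons t r) -> tracked m n (scons u r).
Proof.
intros Heq Ht p G s; eapply prv_iff; [apply track_eq, Heq|apply Ht].
Qed.

Lemma track_comp_eq m n g h t r p G s :
  tracked m m g -> tracked m m h ->
  PA |-- Eq (tsubst g t) (tsubst h t) ->
  (forall i, tsubst g (r i) = tsubst h (r i)) ->
  prv U G (Iff (track m n (scons t r) p (fun i => tsubst s (g i)))
               (track m n (scons t r) p (fun i => tsubst s (h i)))).
Proof.
intros Hg Hh Heq Hgh.
pose proof (track_comp m m n g (scons t r) p G s Hg) as at_g.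
pose proof (track_comp m m n h (scons t r) p G s Hh) as at_h.
pose proof (track_eq m n _ _ (fun i => tsubst h (r i)) p G s Heq) as g_h.
rewrite (track_ext m n _ (scons (tsubst g t) (fun i => tsubst h (r i))) p s s)
  in at_g by (reflexivity || (intros [|i]; [reflexivity|apply Hgh])).
rewrite (track_ext m n _ (scons (tsubst h t) (fun i => tsubst h (r i))) p s s)
  in at_h by (reflexivity || now intros [|i]).
taut at_g at_h g_h.
Qed.

Lemma tracked_open m n r : (forall p, U |-- track m n r p Var) -> tracked m n r.
Proof.
intros Hr p G s; rewrite (track_ext m n r r p s (fun i => tsubst s (Var i)))
  by reflexivity.
rewrite <- subst_track; now apply proves_subst; [apply UPA|].
Qed.

Lemma subst_track_Var q m n r p :
  subst q (track m n r p Var) = track m n r p (fun i => tsubst Var (q i)).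
Proof.
rewrite subst_track; apply track_ext; [reflexivity|].
intros i; now rewrite tsubst_Var.
Qed.

(** [Var 0] is the recursion variable of [t] and [Var 1] an accumulator that is
    replaced by [w] at each step. *)
Lemma tracked_rec k n t w :
  let h := scons (Var 0) (scons w (lift 2)) in
  tracked (1 + k + n) (1 + n) (scons (tsubst (scons Zero Var) t) (lift (1 + k))) ->
  tracked (2 + k + n) (2 + k + n) h ->
  PA |-- Eq (tsubst h t) (tsubst incr t) ->
  tracked (2 + k + n) (1 + n) (scons t (lift (2 + k))).
Proof.
intros h Hzero Hh Heq; apply tracked_open; intros p.
apply proves_induction_parameter with w; fold h; unfold inst;
  rewrite !subst_track_Var.
- eapply prv_iff.
  { eapply (track_comp _ _ _ (scons Zero Var) _ p [] Var), dotted_tracked.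
    dotted_tac. }
  erewrite track_ext; [apply Hzero|pointwise|reflexivity].
- eapply prv_iff; [|apply prv_hyp0].
  eapply (track_comp_eq _ _ h incr t (lift (2 + k)) p _ Var); auto.
  apply dotted_tracked; dotted_tac.
Qed.

Lemma tracked_add n :
  tracked (2 + n) (1 + n) (scons (Add (Var 1) (Var 0)) (lift 2)).
Proof.
apply (tracked_rec 0 n _ (Succ (Var 1))).
- apply tracked_eq with (Var 0); [apply prv_eq_sym, prv_add0|].
  apply dotted_tracked; dotted_tac.
- apply dotted_tracked; dotted_tac.
- apply prv_eq_sym, prv_addS_Sadd.
Qed.

Lemma tracked_mul_add n :
  tracked (3 + n) (1 + n) (scons (Add (Mul (Var 2) (Var 0)) (Var 1)) (lift 3)).
Proof.
apply (tracked_rec 1 n _ (Add (Var 1) (Var 2))).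
- apply tracked_eq with (Var 0); [apply prv_eq_sym, prv_mul0_add|].
  apply dotted_tracked; dotted_tac.
- (* The new accumulator is the sum of two variables, between two renamings. *)
  apply tracked_ext with (fun i => tsubst (scons (Var 2) (scons (Var 1) Var))
    (tsubst (scons (Add (Var 1) (Var 0)) (lift 2))
      (scons (Var 1) (scons (Var 0) (lift 3)) i))); [pointwise|].
  apply tracked_comp with (5 + n); [apply dotted_tracked; dotted_tac|].
  apply tracked_comp with (4 + n); [apply tracked_add|].
  apply dotted_tracked; dotted_tac.
- apply prv_eq_sym, prv_mulS_add.
Qed.

Lemma tracked_mul n :
  tracked (2 + n) (1 + n) (scons (Mul (Var 1) (Var 0)) (lift 2)).
Proof.
apply tracked_eq with (Add (Mul (Var 1) (Var 0)) Zero); [apply prv_add0|].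
apply tracked_ext with (fun i => tsubst (scons (Var 0) (scons Zero (lift 1)))
  (scons (Add (Mul (Var 2) (Var 0)) (Var 1)) (lift 3) i)); [pointwise|].
apply tracked_comp with (3 + n); [|apply tracked_mul_add].
apply dotted_tracked; dotted_tac.
Qed.

Definition all_vars_in_range (m n : nat) (r : nat -> term) : Prop :=
  forall i, i < m -> exists j, j < n /\ r j = Var i.

Lemma all_vars_in_range_scons m n t r :
  all_vars_in_range m n r -> all_vars_in_range m (1 + n) (scons t r).
Proof.
intros Hr i Hi; destruct (Hr i Hi) as (j & Hj & Hrj).
exists (S j); split; [simpl; lia|exact Hrj].
Qed.

(** Keeping the variables of [t] in the range of [r] lets the subterms of [t] be
    put in one after the other. *)
Lemma tracked_scons m n r t :
  tbound m t -> all_vars_in_range m n r ->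
  tracked m n r -> tracked m (1 + n) (scons t r).
Proof.
revert n r; induction t as [i| |t IH|t IHt u IHu|t IHt u IHu];
  intros n r Ht Hr Htr.
- destruct (Hr i Ht) as (j & Hj & <-).
  apply tracked_ext with (fun i => tsubst r (scons (Var j) Var i)); [pointwise|].
  apply tracked_comp with n; [exact Htr|apply dotted_tracked; dotted_tac].
- apply tracked_ext with (fun i => tsubst r (scons Zero Var i)); [pointwise|].
  apply tracked_comp with n; [exact Htr|apply dotted_tracked; dotted_tac].
- apply tracked_ext with (fun i => tsubst (scons t r) (incr i)); [pointwise|].
  apply tracked_comp with (1 + n); [auto|apply dotted_tracked; dotted_tac].
- destruct Ht as [Ht Hu].
  apply tracked_ext with (fun i => tsubst (scons u (scons t r))
    (scons (Add (Var 1) (Var 0)) (lift 2) i)); [pointwise|].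
  apply tracked_comp with (2 + n); [|apply tracked_add].
  apply (IHu (1 + n)); auto using all_vars_in_range_scons.
- destruct Ht as [Ht Hu].
  apply tracked_ext with (fun i => tsubst (scons u (scons t r))
    (scons (Mul (Var 1) (Var 0)) (lift 2) i)); [pointwise|].
  apply tracked_comp with (2 + n); [|apply tracked_mul].
  apply (IHu (1 + n)); auto using all_vars_in_range_scons.
Qed.

Lemma tracked_inst n t : tbound n t -> tracked n (1 + n) (scons t Var).
Proof.
intros Ht; apply tracked_scons; [exact Ht|intros i Hi; now exists i|].
apply dotted_tracked; dotted_tac.
Qed.

Lemma PrDot_inst G s n p t :
  tbound n t ->
  prv U G (Iff (PrDot s n (inst p t)) (PrDot (scons (tsubst s t) s) (1 + n) p)).
Proof.
intros Ht.
rewrite (PrDot_ext (scons (tsubst s t) s) (fun i => tsubst s (scons t Var i)))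
  by pointwise.
exact (tracked_inst n t Ht p G s).
Qed.

Lemma PrDot_inst_eq G s n p t u :
  tbound n t -> tbound n u -> prv U G (Eq (tsubst s t) (tsubst s u)) ->
  prv U G (Iff (PrDot s n (inst p t)) (PrDot s n (inst p u))).
Proof.
intros Ht Hu Heq; eapply iff_trans; [apply PrDot_inst, Ht|].
eapply iff_trans; [apply PrDot_eq, Heq|apply iff_sym, PrDot_inst, Hu].
Qed.

(** * Formulas decided inside the provability predicate *)

Lemma subst_scons_ite_shift t s c p q :
  subst (scons t s) (ite c (shift p) (shift q)) =
  ite (subst (scons t s) c) (subst s p) (subst s q).
Proof. unfold ite, Neg, shift; cbn [subst]; now rewrite !subst_comp. Qed.

Lemma inst_ite_shift c p q t :
  inst (ite c (shift p) (shift q)) t = ite (inst c t) p q.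
Proof. unfold inst; now rewrite subst_scons_ite_shift, !subst_Var. Qed.

Definition decided (n : nat) (c : form) : Prop :=
  forall p q G s, prv U G
    (decides (subst s c) (PrDot s n (ite c p q)) (PrDot s n p) (PrDot s n q)).

Lemma decided_iff n c d : PA |-- Iff c d -> decided n c -> decided n d.
Proof.
intros Hcd Hc p q G s.
assert (inside : T |-- Iff c d) by now apply extends_PA_stronger.
assert (same : prv U G (Iff (PrDot s n (ite c p q)) (PrDot s n (ite d p q)))).
{ apply PrDot_iff; taut inside. }
assert (outside : prv U G (Iff (subst s c) (subst s d)))
  by exact (PA_instance s G _ Hcd).
taut (Hc p q G s) same outside.
Qed.

Lemma decided_Bot n : decided n Bot.
Proof.
intros p q G s; cbn [subst].
assert (same : prv U G (Iff (PrDot s n (ite Bot p q)) (PrDot s n q))).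
{ apply PrDot_iff; taut. }
taut same.
Qed.

Lemma decided_Imp n c d : decided n c -> decided n d -> decided n (Imp c d).
Proof.
intros Hc Hd p q G s; cbn [subst].
assert (nested : prv U G (Iff (PrDot s n (ite (Imp c d) p q))
                              (PrDot s n (ite c (ite d p q) p)))).
{ apply PrDot_iff; taut. }
taut nested (Hc (ite d p q) p G s) (Hd p q G s).
Qed.

Lemma decided_Neg n c : decided n c -> decided n (Neg c).
Proof. intros Hc; apply decided_Imp; [exact Hc|apply decided_Bot]. Qed.

Lemma decided_And n c d : decided n c -> decided n d -> decided n (And c d).
Proof.
intros Hc Hd; apply decided_iff with (Neg (Imp c (Neg d))); [taut|].
auto using decided_Imp, decided_Neg.
Qed.

Lemma decided_Or n c d : decided n c -> decided n d -> decided n (Or c d).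
Proof.
intros Hc Hd; apply decided_iff with (Imp (Neg c) d); [taut|].
auto using decided_Imp, decided_Neg.
Qed.

(** With a witness [Var 0] for t <= u, the quoted u becomes [Add (Var 0) t]. *)
Lemma PrDot_le_witness G s n t u p q :
  tbound n t -> tbound n u -> prv U G (Le (tsubst s t) (tsubst s u)) ->
  T |-- Iff (subst (scons (Add (Var 0) (tshift t)) (lift 1)) p)
            (subst (lift 1) q) ->
  prv U G (Iff (PrDot s n (inst p u)) (PrDot s n q)).
Proof.
intros Ht Hu Hle Hpq; apply prv_leE with (1 := Hle).
change (shift (Iff ?a ?b)) with (Iff (shift a) (shift b)).
rewrite !shift_PrDot, !tshift_tsubst.
change (shift (inst p u)) with (subst (lift 1) (inst p u)); rewrite subst_inst.
eapply iff_trans; [apply PrDot_inst_eq with (u := Add (Var 0) (tshift t))|].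
- now apply tbound_tshift.
- split; [simpl; lia|now apply tbound_tshift].
- apply prv_eq_sym, prv_hyp0.
- rewrite <- subst_scons; now apply PrDot_iff.
Qed.

Lemma PrDot_ite_le_true G s n t u p q :
  tbound n t -> tbound n u -> prv U G (Le (tsubst s t) (tsubst s u)) ->
  prv U G (Iff (PrDot s n (ite (Le t u) p q)) (PrDot s n p)).
Proof.
intros Ht Hu Hle.
replace (Le t u) with (inst (Le (tshift t) (Var 0)) u)
  by (unfold inst; simpl; now rewrite tshift_inst).
rewrite <- inst_ite_shift; apply PrDot_le_witness with t;
  [exact Ht|exact Hu|exact Hle|].
rewrite subst_scons_ite_shift; cbn [subst tsubst scons].
rewrite tsubst_scons_tshift.
assert (le_add : T |-- Le (tsubst (lift 1) t) (Add (Var 0) (tshift t))).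
{ apply prv_leI with (Var 0), P_EqI. }
taut le_add.
Qed.

Lemma PrDot_ite_le_false G s n t u p q :
  tbound n t -> tbound n u -> prv U G (Le (Succ (tsubst s u)) (tsubst s t)) ->
  prv U G (Iff (PrDot s n (ite (Le t u) p q)) (PrDot s n q)).
Proof.
intros Ht Hu Hlt.
replace (Le t u) with (inst (Le (Var 0) (tshift u)) t)
  by (unfold inst; simpl; now rewrite tshift_inst).
rewrite <- inst_ite_shift; apply PrDot_le_witness with (Succ u);
  [exact Hu|exact Ht|exact Hlt|].
rewrite subst_scons_ite_shift; cbn [subst tsubst scons].
rewrite tsubst_scons_tshift.
assert (add_nle :
  T |-- Neg (Le (Add (Var 0) (tshift (Succ u))) (tsubst (lift 1) u))).
{ exact (prv_add_succ_nle [] (Var 0) (tshift u)). }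
taut add_nle.
Qed.

Lemma decided_Le n t u : tbound n t -> tbound n u -> decided n (Le t u).
Proof.
intros Ht Hu p q G s; cbn [subst]; apply P_AndI; apply P_ImpI.
- apply PrDot_ite_le_true; auto using prv_hyp0.
- apply PrDot_ite_le_false; [exact Ht|exact Hu|].
  eapply P_ImpE; [|apply prv_hyp0].
  taut (prv_le_total (T := U) (Neg (Le (tsubst s t) (tsubst s u)) :: G)
    (tsubst s t) (tsubst s u)).
Qed.

Lemma decided_Eq n t u : tbound n t -> tbound n u -> decided n (Eq t u).
Proof.
intros Ht Hu; apply decided_iff with (1 := prv_not_lt_iff_eq [] t u).
apply decided_And; apply decided_Neg, decided_Le; assumption.
Qed.

(** [p] and [q] do not contain the induction variable [Var 0] of [c]: this keeps
    them fixed in the induction below. *)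
Definition fresh_decision (n : nat) (c p q : form) (s : nat -> term) : form :=
  decides (subst s c) (PrDot s (1 + n) (ite c (shift p) (shift q)))
    (PrDot (fun i => s (S i)) n p) (PrDot (fun i => s (S i)) n q).

Lemma subst_fresh_decision r n c p q s :
  subst r (fresh_decision n c p q s) =
  fresh_decision n c p q (fun i => tsubst r (s i)).
Proof.
unfold fresh_decision, decides, Iff, Neg; cbn [subst].
now rewrite subst_comp, !subst_PrDot.
Qed.

Lemma fresh_decision_inst G n c p q t s :
  tbound n t ->
  prv U G (Iff (fresh_decision n c p q (scons (tsubst s t) s))
    (decides (subst s (inst c t)) (PrDot s n (ite (inst c t) p q))
       (PrDot s n p) (PrDot s n q))).
Proof.
intros Ht; unfold fresh_decision.
pose proof (PrDot_inst G s n (ite c (shift p) (shift q)) t Ht) as put_t.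
rewrite inst_ite_shift in put_t.
replace (subst s (inst c t)) with (subst (scons (tsubst s t) s) c) by subst_eq.
change (fun i => scons (tsubst s t) s (S i)) with s; taut put_t.
Qed.

Lemma fresh_decision_incr G n c d p q :
  decided (1 + n) d -> PA |-- Iff (subst incr c) (And c d) ->
  prv U G (fresh_decision n c p q Var) -> prv U G (fresh_decision n c p q incr).
Proof.
intros Hd Hcd IH; unfold fresh_decision in *.
rewrite <- (PrDot_shift Var n p), <- (PrDot_shift Var n q) in IH.
change (fun i => incr (S i)) with (fun i => Var (S i)).
rewrite <- (PrDot_shift Var n p), <- (PrDot_shift Var n q).
set (p' := shift p) in *; set (q' := shift q) in *.
assert (put_incr : PrDot incr (1 + n) (ite c p' q') =
  PrDot Var (1 + n) (ite (subst incr c) p' q')).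
{ rewrite (PrDot_ext incr (fun i => tsubst Var (incr i))) by pointwise.
  rewrite <- (PrDot_subst Var (1 + n) (1 + n) incr) by dotted_tac.
  apply f_equal, subst_scons_ite_shift. }
assert (unfold_incr : prv U G (Iff (PrDot Var (1 + n) (ite (subst incr c) p' q'))
  (PrDot Var (1 + n) (ite d (ite c p' q') q')))).
{ apply PrDot_iff; pose proof (extends_PA_stronger (T := T) _ Hcd) as inside.
  taut inside. }
assert (outside : prv U G (Iff (subst incr c) (And c d))).
{ apply prv_nil; now apply extends_PA_stronger. }
rewrite subst_Var in IH; pose proof (Hd (ite c p' q') q' G Var) as d_decided.
rewrite subst_Var in d_decided.
rewrite put_incr; taut unfold_incr outside d_decided IH.
Qed.

Lemma decided_induction n c d t :
  tbound n t -> decided n (inst c Zero) -> decided (1 + n) d ->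
  PA |-- Iff (subst incr c) (And c d) -> decided n (inst c t).
Proof.
intros Ht Hzero Hd Hcd p q G s; eapply prv_iff; [now apply fresh_decision_inst|].
assert (open : U |-- fresh_decision n c p q Var).
{ apply proves_induction; unfold inst; rewrite subst_fresh_decision.
  - eapply prv_iff; [apply iff_sym, (fresh_decision_inst [] n c p q Zero Var)|];
      [exact I|apply Hzero].
  - apply (fresh_decision_incr _ n c d); auto using prv_hyp0. }
apply (proves_subst extends_PA_sentences (scons (tsubst s t) s) G) in open.
rewrite subst_fresh_decision in open; exact open.
Qed.

Lemma decided_ball n t p :
  tbound n t -> fbound (1 + n) p ->
  (forall m r, fbound m (subst r p) -> decided m (subst r p)) ->
  decided n (ball t p).
Proof.
intros Ht Hp decided_instances.
set (p' := subst (scons (Var 0) (lift 2)) p).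
assert (ball_inst : forall u, ball u p = inst (ball (Var 0) p') u).
{ intros u; unfold ball, p', inst; cbn [subst]; do 2 f_equal.
  rewrite subst_comp, subst_id; [reflexivity|pointwise]. }
rewrite ball_inst; apply decided_induction with (inst p' (Succ (Var 0))); trivial.
- rewrite <- ball_inst.
  apply decided_iff with (1 := iff_sym _ _ _ (prv_ball0 [] p)).
  apply decided_instances, fbound_inst; [exact Hp|exact I].
- unfold inst, p'; rewrite subst_comp; apply decided_instances.
  apply fbound_subst with (1 := Hp); intros [|i] Hi; simpl; lia.
- replace (subst incr (ball (Var 0) p')) with (ball (Succ (Var 0)) p').
  + apply prv_ballS.
  + unfold ball, p'; cbn [subst]; do 2 f_equal; subst_eq.
Qed.

(** Instances of [d] are included because the induction on a bounded quantifier
    puts terms for the bound variable. *)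
Lemma decided_Delta0 d n r :
  Delta0 d -> fbound n (subst r d) -> decided n (subst r d).
Proof.
intros Hd; revert n r.
induction Hd as [|t u|t u|p q _ IHp _ IHq|p q _ IHp _ IHq|p q _ IHp _ IHq
  |t p _ IH|t p _ IH]; cbn [subst]; intros n r Hn.
- apply decided_Bot.
- destruct Hn; now apply decided_Eq.
- destruct Hn; now apply decided_Le.
- destruct Hn; apply decided_Imp; auto.
- destruct Hn; apply decided_And; auto.
- destruct Hn; apply decided_Or; auto.
- rewrite <- tshift_tsubst in *; destruct Hn as [[_ Ht] Hp]; apply decided_ball.
  + now apply tbound_tshift.
  + exact Hp.
  + intros m s; rewrite subst_comp; apply IH.
- rewrite <- tshift_tsubst in *; destruct Hn as [[_ Ht] Hp].
  apply decided_iff with (1 := iff_sym _ _ _ (prv_bex_ball [] (tsubst r t) _)).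
  apply decided_Neg, decided_ball.
  + now apply tbound_tshift.
  + split; [exact Hp|exact I].
  + intros m s [Hs _]; cbn [subst Neg]; apply decided_Neg.
    rewrite subst_comp in *; now apply IH.
Qed.

(** * D2 and D3 *)

Hypothesis Pr_intro : forall p, T |-- p -> U |-- inst Pr (quote p).

Lemma PrDot_Neg_Bot G s n : prv U G (PrDot s n (Neg Bot)).
Proof.
change (PrDot s n (Neg Bot)) with (PrDot s 0 (Neg Bot)).
eapply prv_iff; [apply iff_sym, PrDot_0|].
apply prv_nil, Pr_intro; taut.
Qed.

Lemma Delta0_complete d n :
  Delta0 d -> fbound n d -> U |-- Imp d (inst Pr (gdot n d)).
Proof.
intros Hd Hn; rewrite <- PrDot_Var.
assert (d_decided : decided n d).
{ rewrite <- (subst_Var d) in Hn |- *; now apply decided_Delta0. }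
specialize (d_decided (Neg Bot) Bot [] Var); rewrite subst_Var in d_decided.
assert (ite_d : U |-- Iff (PrDot Var n d) (PrDot Var n (ite d (Neg Bot) Bot))).
{ apply PrDot_iff; taut. }
taut d_decided ite_d (PrDot_Neg_Bot [] Var n).
Qed.

Hypothesis Pr_CBex : cond_CBex U Pr.

Lemma Sigma1_complete p :
  Sigma1 p -> fbound 0 p -> U |-- Imp p (inst Pr (quote p)).
Proof.
intros (n & d & Hd & ->) Hn; rewrite fbound_exn, Nat.add_0_r in Hn.
pose proof (exn_mono n _ _ (Delta0_complete d n Hd Hn)) as complete.
taut complete (Pr_CBex n d).
Qed.

Lemma Pr_mono p q :
  T |-- Imp p q -> U |-- Imp (inst Pr (quote p)) (inst Pr (quote q)).
Proof.
intros Hpq; set (x := And (shift q) (Imp (Eq (Var 0) Zero) (shift p))).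
assert (x_inst : forall t, inst x t = And q (Imp (Eq t Zero) p)).
{ intros t; unfold x; rewrite <- (inst_shift p t) at 2.
  now rewrite <- (inst_shift q t) at 2. }
assert (x_zero : U |-- Iff (PrDot (scons Zero Var) 1 x) (PrDot Var 0 p)).
{ rewrite (PrDot_ext _ (fun i => tsubst Var (scons Zero Var i))) by pointwise.
  rewrite <- (PrDot_subst Var 0 1 (scons Zero Var)) by dotted_tac.
  change (subst (scons Zero Var) x) with (inst x Zero); rewrite x_inst.
  apply PrDot_iff; taut Hpq (P_EqI T [] Zero). }
assert (Ex_x : T |-- Iff (Ex x) q).
{ apply P_AndI; apply P_ImpI.
  - eapply P_ExE; [apply prv_hyp0|]; eapply P_AndE1, prv_hyp0.
  - apply P_ExI with (Succ Zero); rewrite x_inst.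
    apply P_ImpE with q; [taut (prv_succ_neq0 (T := T) [q] Zero)|apply prv_hyp0]. }
assert (x_zero_Ex : U |-- Imp (PrDot (scons Zero Var) 1 x)
                              (inst Pr (quote (Ex x)))).
{ apply P_ImpI; eapply P_ImpE; [apply prv_nil, (Pr_CBex 1 x)|].
  apply P_ExI with Zero.
  rewrite <- PrDot_Var; unfold inst; rewrite subst_PrDot; apply prv_hyp0. }
assert (Pr_Ex_x : U |-- Iff (inst Pr (quote (Ex x))) (inst Pr (quote q))).
{ taut (PrDot_iff [] Var 0 _ _ Ex_x) (PrDot_0 [] Var (Ex x)) (PrDot_0 [] Var q). }
taut x_zero x_zero_Ex Pr_Ex_x (PrDot_0 [] Var p).
Qed.

Lemma cond_C_D2 : cond_C U Pr -> cond_D2 U Pr.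
Proof.
intros Pr_C p q.
assert (modus_ponens : T |-- Imp (And (Imp p q) p) q) by taut.
taut (Pr_C (Imp p q) p) (Pr_mono _ _ modus_ponens).
Qed.

Lemma Sigma1_cond_D3 : Sigma1 Pr -> cond_D3 U Pr.
Proof.
intros Pr_Sigma1 p; apply Sigma1_complete; [now apply Sigma1_subst|].
apply fbound_inst; [exact Pr_bound|apply tbound_num].
Qed.

End Provability.

Theorem corollary3p18 (S T : form -> Prop)
  (S_ext : ce_extension_of_PA S) (S_con : consistent S)
  (T_ext : ce_extension_of_PA T) (T_con : consistent T)
  (TS : stronger T S)
  (Pr : form)
  (Pr_prov : provability_predicate S T Pr)
  (Pr_Sigma1 : Sigma1 Pr)
  (Pr_EU : cond_EU S T Pr)
  (Pr_CBex : cond_CBex S Pr)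
  (Pr_C : cond_C S Pr) :
  cond_D2 S Pr /\ cond_D3 S Pr.
Proof.
apply ce_extension_extends_PA in S_ext, T_ext.
destruct Pr_prov as [Pr_bound Pr_iff].
split.
- apply (cond_C_D2 (T := T)); assumption.
- apply (Sigma1_cond_D3 (T := T)); try assumption; apply Pr_iff.
Qed.
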